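(* Let $d\geq 2$ be a fixed integer. Hyperbolicity of polynomials of degree $d$ is a semi-decidable property on $\mathbb{C}^{d-1}$. More precisely, there exists a Turing machine that, on input of an oracle of $c\in\mathbb{C}^{d-1}$, halts if $p_c$ is hyperbolic, and runs forever if $p_c$ is not hyperbolic.
   Context: For $c=(a_0,a_1,\dots,a_{d-2})\in\mathbb{C}^{d-1}$, $p_c$ denotes the polynomial $p_c(z)=z^d+a_{d-2}z^{d-2}+\cdots+a_1z+a_0$. The Julia set $J$ of a polynomial $p$ of degree at least $2$ is the topological boundary of the set of points of $\mathbb{C}$ with bounded forward orbit under $p$. The polynomial $p$ is hyperbolic if it is uniformly expanding on its Julia set, i.e. there are constants $C>0$ and $\Lambda>1$ such that $|(p^n)'(z)|\geq C\Lambda^n$ for all $z\in J$ and all $n\in\mathbb{N}$, where $p^n$ is the $n$-th iterate. An oracle of a point $x\in\mathbb{R}^\ell$ is a function $\phi:\mathbb{N}\to\mathbb{Q}^\ell$ with $\|\phi(n)-x\|<2^{-n}$ for all $n$; $\mathbb{C}^\ell$ is identified with $\mathbb{R}^{2\ell}$. The point $c$ is not required to be computable; the Turing machine may query the oracle at any precision. *)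

(* Defs.v *)
From HB Require Import structures.
From mathcomp Require Import all_boot all_order all_algebra.
From mathcomp Require Import complex.
From mathcomp Require Import all_classical all_reals all_analysis.
Import Order.TTheory GRing.Theory Num.Theory.
Import numFieldNormedType.Exports.

Set Implicit Arguments.
Unset Strict Implicit.
Unset Printing Implicit Defensive.

Local Open Scope classical_set_scope.
Local Open Scope ring_scope.

(* Packing R[i] as a numClosedFieldType gives it the topology of its modulus
   (numFieldNormedType). The norm `|z| is R[i]-valued, with zero imaginary
   part, and complex.Re `|z| is the modulus as a real number. *)
Definition C (R : realType) : numClosedFieldType := R[i].

Section Dynamics.
Variable R : realType.
Implicit Type p : {poly C R}.

Definition monic_centered d (c : 'rV[C R]_d.-1) : {poly C R} :=
  'X^d + \sum_(i < d.-1) c 0 i *: 'X^i.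

Definition filled_julia p : set (C R) :=
  [set z | bounded_set (range (fun n => iter n (horner p) z))].

Definition boundary (T : topologicalType) (A : set T) : set T :=
  closure A `\` interior A.

Definition julia p : set (C R) := boundary (filled_julia p).

Definition iter_poly p n : {poly C R} := iter n (fun q => p \Po q) 'X.

Definition hyperbolic p : Prop :=
  exists K L : R, [/\ 0 < K, 1 < L &
    forall z, julia p z -> forall n,
      K * L ^+ n <= complex.Re `|(iter_poly p n)^`().[z]|].

End Dynamics.

Section Oracle.
Variable R : realType.

(* The norm that mathcomp-analysis puts on matrices is the sup norm. *)
Definition euclidean_norm l (x : 'rV[R]_l) : R :=
  Num.sqrt (\sum_(j < l) x 0 j ^+ 2).

Definition is_oracle l (x : 'rV[R]_l) (phi : nat -> 'rV[rat]_l) : Prop :=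
  forall n, euclidean_norm (map_mx ratr (phi n) - x) < 2 ^- n.

Definition realify l (c : 'rV[C R]_l) : 'rV[R]_(l + l) :=
  row_mx (map_mx (@complex.Re R) c) (map_mx (@complex.Im R) c).

End Oracle.

Inductive io_symbol := One | Minus | Stop.

Definition io_symbol_code (s : io_symbol) : 'I_3 :=
  match s with One => inord 0 | Minus => inord 1 | Stop => inord 2 end.

Definition io_symbol_decode (i : 'I_3) : io_symbol :=
  match val i with 0%N => One | 1%N => Minus | _ => Stop end.

Lemma io_symbol_codeK : cancel io_symbol_code io_symbol_decode.
Proof. by case; rewrite /io_symbol_decode /= inordK. Qed.

HB.instance Definition _ := Countable.copy io_symbol (can_type io_symbol_codeK).
HB.instance Definition _ := Finite.copy io_symbol (can_type io_symbol_codeK).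

(* A rational is written as its sign, then its numerator and denominator in
   lowest terms, both in unary and each closed by Stop. *)
Definition write_rat (q : rat) : seq io_symbol :=
  nseq (numq q < 0)%R Minus ++ nseq `|numq q|%N One ++ [:: Stop]
    ++ nseq `|denq q|%N One ++ [:: Stop].

Definition write_vec l (v : 'rV[rat]_l) : seq io_symbol :=
  flatten [seq write_rat (v 0 j) | j <- enum 'I_l].

(* Two-way infinite tapes, blank (None) outside a finite window: (u, v) has the
   scanned cell at the head of v, and u lists the cells to its left, the
   nearest one first. *)
Section Tape.
Variable S : Type.

Definition tape : Type := (seq (option S) * seq (option S))%type.

Inductive move := MoveLeft | Stay | MoveRight.

Definition blank_tape : tape := ([::], [::]).

Definition scan (t : tape) : option S := head None t.2.

Definition write (t : tape) (a : option S) : tape := (t.1, a :: behead t.2).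

Definition move_head (m : move) (t : tape) : tape :=
  match m with
  | MoveLeft => (behead t.1, head None t.1 :: t.2)
  | Stay => t
  | MoveRight => (scan t :: t.1, behead t.2)
  end.

End Tape.

(* Deterministic multitape oracle machines. Tape ord0 is the query tape and
   tape ord_max the answer tape; they are distinct, and in an ordinary step
   the machine reads and writes them like the others. *)
Record oracle_machine := OracleMachine {
  om_state : finType;
  om_extra : finType;
  om_work : nat;
  om_start : om_state;
  om_halt : om_state;
  om_query : om_state;
  om_reply : om_state;
  om_trans : om_state ->
    {ffun 'I_om_work.+2 -> option (io_symbol + om_extra)} ->
    om_state * ('I_om_work.+2 -> option (io_symbol + om_extra) * move)
}.

Section Run.
Variables (M : oracle_machine) (l : nat) (phi : nat -> 'rV[rat]_l).

Notation symbol := (io_symbol + om_extra M)%type.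

Record config := Config {
  cf_state : om_state M;
  cf_tape : 'I_(om_work M).+2 -> tape symbol
}.

Definition init_config : config :=
  Config (om_start M) (fun=> blank_tape symbol).

Definition query_value (t : tape symbol) : nat :=
  count_mem (Some (inl One)) (t.1 ++ t.2).

Definition reply_tape (s : seq io_symbol) : tape symbol :=
  ([::], [seq Some (inl a) | a <- s]).

Definition query_step (cf : config) : config :=
  let n := query_value (cf_tape cf ord0) in
  Config (om_reply M)
    (fun i => if i == ord_max then reply_tape (write_vec (phi n))
              else cf_tape cf i).

Definition trans_step (cf : config) : config :=
  let qa := om_trans (cf_state cf) [ffun i => scan (cf_tape cf i)] in
  Config qa.1
    (fun i => move_head (qa.2 i).2 (write (cf_tape cf i) (qa.2 i).1)).

Definition step (cf : config) : config :=
  if cf_state cf == om_halt M then cf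
  else if cf_state cf == om_query M then query_step cf
  else trans_step cf.

Definition halts : Prop :=
  exists t, cf_state (iter t step init_config) = om_halt M.

Definition runs_forever : Prop :=
  forall t, cf_state (iter t step init_config) <> om_halt M.

End Run.

(* Main.v *)
Require Import Defs.
From mathcomp Require Import all_boot all_order all_algebra.
From mathcomp Require Import complex.
From mathcomp Require Import all_classical all_reals all_analysis.
From mathcomp Require Import zify ring lra.
Import Order.TTheory GRing.Theory Num.Theory.
Import numFieldNormedType.Exports.

(** Hyperbolicity of a monic centered polynomial p can be certified by a finite
table. The table is coded by a natural number x, which also bounds the parameters
of the grid that it labels, and the machine tries x = 0, 1, 2, ... in turn: it
asks the oracle for c at precision x and tests the table with exact rational
arithmetic on the answer. So three things are needed: a valid table proves
hyperbolicity, every hyperbolic polynomial has a valid table, and the test can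
be carried out by a Turing machine.

The table labels the nodes of a grid of mesh 1/(N+1) on a square that contains
the filled Julia set. Write q -> q' when the node q' lies so close to the
approximate value of p at q that, for all the table knows, p may map a point of
the cell around q into the cell around q'. A label is a kind with a value, and
the rules are as follows.
 - Trap (kind 0): all arrows lead to trap nodes, and p(q) is well inside the
   square.
 - Escape (kind 1): all arrows lead to escape nodes of strictly larger value.
 - Expanding (kind 2): an arrow q -> q' to another expanding node satisfies
   (r' + 1) |p'(q)|^2 >= r + 2, up to a margin, where r and r' are the values.

Soundness [valid_hyperbolic]. An open cell around a trap node has bounded
forward orbits, hence lies in the interior of the filled Julia set. An orbit in
the Julia set never leaves the square, so it cannot climb through escape nodes
for ever. Hence the Julia set, which is forward invariant, only meets cells of
expanding nodes. As the values are bounded by some b, the third rule and the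
chain rule make |(p^n)'|^2 (r_n + 1), where r_n is the value at the n-th point of
the orbit, grow at least by the factor 1 + 1/(b + 1) at each step; this is uniform
expansion.

Completeness [hyperbolic_accepted]. For hyperbolic p choose n such that
|(p^n)'|^2 >= 2 on the Julia set J. The function rho = sum_(j < n) |(p^j)'|^2
satisfies rho(p(z)) |p'(z)|^2 = rho(z) - 1 + |(p^n)'(z)|^2 [weight_horner], so
near J it grows by a definite amount: rounded multiples of rho are the values of
the expanding nodes. Measuring distances to J with the weight rho makes p
expand them [contraction], so a neighbourhood V of J has its preimage in V, with
room to spare [vicinity_backward]. A node outside V is a trap node or an escape
node according to whether it belongs to the filled Julia set, and arrows preserve
this because a segment from the filled Julia set to its complement meets J
[julia_between]. Escape values come from sum_(j < T) |p^j|^2, which increases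
along p by the same telescoping as soon as T steps take every escaping point
outside V beyond the square; such a T exists by compactness [uniform_escape].
The local inverse of p that contraction requires comes from algebra: the product
of the distances of z to the solutions of p(z') = w is |p(z) - w|, so one of them
is near z [preimage_near].

The machine [semidecidable]. Registers are tapes that hold a number in unary.
The functions whose value can be left in a fresh register form a class
[computable] that is closed under primitive recursion; it contains arithmetic
and comparison of rationals, and decides bounded quantification, which is all
that the test of a table uses [accepts_computable]. *)

Set Implicit Arguments.
Unset Strict Implicit.
Unset Printing Implicit Defensive.

Local Open Scope nat_scope.

(** * Oracle-free programs as finite automata with exits *)
Notation symb := (io_symbol + void)%type.

Section Components.
Variable k : nat.
Notation tapes := ('I_k.+2 -> tape symb).
Notation actions := ('I_k.+2 -> option symb * move).
Notation symbols := {ffun 'I_k.+2 -> option symb}.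

(** The next state [None] leaves the component. Programs are thus composed
without naming the states that follow them, and become parts of a machine once
their exit is directed to one of its states. *)
Record component := Component {
  cp_state : finType;
  cp_start : cp_state;
  cp_trans : cp_state -> symbols -> option cp_state * actions
}.

Definition scanned (t : tapes) : symbols := [ffun i => scan (t i)].

Definition perform (t : tapes) (a : actions) : tapes :=
  fun i => move_head (a i).2 (write (t i) (a i).1).

Definition keep (f : symbols) : actions := fun i => (f i, Stay).

(** Only terminating runs have a derivation, so that [triple] below asserts total
correctness. *)
Inductive exec (P : component) : cp_state P -> tapes -> tapes -> Prop :=
| exec_exit q t a : cp_trans q (scanned t) = (None, a) ->
    exec q t (perform t a)
| exec_step q t q' a t' : cp_trans q (scanned t) = (Some q', a) ->
    exec q' (perform t a) t' -> exec q t t'.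

Definition triple (A : tapes -> Prop) (P : component) (B : tapes -> Prop) :=
  forall t, A t -> exists2 t', exec (cp_start P) t t' & B t'.

Definition atom (a : symbols -> actions) : component :=
  @Component unit tt (fun _ f => (None, a f)).

Definition seqc (P Q : component) : component :=
  @Component (cp_state P + cp_state Q)%type (inl (cp_start P))
    (fun q f => match q with
     | inl q => let r := cp_trans q f in
         (Some (if r.1 is Some q' then inl q' else inr (cp_start Q)), r.2)
     | inr q => let r := cp_trans q f in (omap inr r.1, r.2)
     end).

Definition whilec (b : pred symbols) (P : component) : component :=
  @Component (option (cp_state P)) None
    (fun q f => match q with
     | None => (if b f then Some (Some (cp_start P)) else None, keep f)
     | Some q => let r := cp_trans q f in (Some r.1, r.2)
     end).

Lemma triple_atom (A B : tapes -> Prop) (a : symbols -> actions) :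
  (forall t, A t -> B (perform t (a (scanned t)))) -> triple A (atom a) B.
Proof. by move=> h t At; exists (perform t (a (scanned t))); [exact: exec_exit|exact: h]. Qed.

Lemma triple_conseq (A A' B B' : tapes -> Prop) P : triple A P B ->
  (forall t, A' t -> A t) -> (forall t, B t -> B' t) -> triple A' P B'.
Proof. by move=> h hA hB t /hA/h[t' e /hB]; exists t'. Qed.

Lemma triple_post (A B B' : tapes -> Prop) P : triple A P B ->
  (forall t, B t -> B' t) -> triple A P B'.
Proof. by move=> h hB; exact: triple_conseq h (fun _ => id) hB. Qed.

Lemma triple_seq (A B D : tapes -> Prop) P Q :
  triple A P B -> triple B Q D -> triple A (seqc P Q) D.
Proof.
move=> hP hQ t /hP[t1 e1 /hQ[t2 e2 Dt2]]; exists t2 => //.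
rewrite [cp_start _]/=; elim: e1 e2 => {t t1} [q t a E|q t q' a t1 E _ IH] e2.
- apply: (@exec_step (seqc P Q) _ _ (inr (cp_start Q)) a); first by rewrite /= E.
  elim: e2 => {q t a E t2 Dt2} [q t a E|q t q' a t2 E _ IH].
    by apply: (@exec_exit (seqc P Q)); rewrite /= E.
  by apply: (@exec_step (seqc P Q) _ _ (inr q') a); rewrite /= ?E.
- by apply: (@exec_step (seqc P Q) _ _ (inl q') a); rewrite /= ?E//; exact: IH.
Qed.

(** The invariant is indexed by the number of remaining rounds, which the test
detects to be zero or not; that index is what makes the loop terminate. *)
Lemma triple_while (b : pred symbols) P (Inv : nat -> tapes -> Prop) :
  (forall n t, Inv n t -> b (scanned t) = (0 < n)) ->
  (forall n t, Inv n t -> Inv n (perform t (keep (scanned t)))) ->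
  (forall n, triple (Inv n.+1) P (Inv n)) ->
  forall n, triple (Inv n) (whilec b P) (Inv 0).
Proof.
move=> hb hk hP; elim=> [|n IH] t It.
  exists (perform t (keep (scanned t))); last exact: hk.
  by apply: (@exec_exit (whilec b P)); rewrite /= (hb _ _ It).
have [t1 e1 /IH[t2 e2 I2]] := hP n _ (hk _ _ It).
exists t2 => //; rewrite [cp_start _]/=.
apply: (@exec_step (whilec b P) _ _ (Some (cp_start P))
  (keep (scanned t))); first by rewrite /= (hb _ _ It).
move: e2; rewrite [cp_start _]/=.
elim: e1 => {t It t1} [q t a E|q t q' a t1 E _ IH'] e2.
  by apply: (@exec_step (whilec b P) _ _ None a); rewrite /= ?E.
by apply: (@exec_step (whilec b P) _ _ (Some q') a); rewrite /= ?E//; exact: IH'.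
Qed.

End Components.

(** * Unary counters on tapes *)
Section Registers.
Variable k : nat.
Notation tapes := ('I_k.+2 -> tape symb).

Definition stroke : option symb := Some (inl One).

(** The head stands on the first stroke, so that scanning it compares the number
with zero. The amount of explicit blanks is left free: a step that rewrites the
scanned blank beyond the end of a list makes that blank explicit. *)
Definition counter (n : nat) (t : tape symb) : Prop :=
  exists a b, t = (nseq a None, nseq n stroke ++ nseq b None).

(** What is left of the head does not matter, as the answer is read once from
left to right. *)
Definition holds (s : seq io_symbol) (t : tape symb) : Prop :=
  exists b, t.2 = [seq Some (inl a) | a <- s] ++ nseq b None.

Definition represents (m : nat -> nat) s (t : tapes) : Prop :=
  (forall i : 'I_k.+2, i != ord_max -> counter (m i) (t i)) /\
  holds s (t ord_max).

Definition upd (m : nat -> nat) r v : nat -> nat :=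
  fun i => if i == r then v else m i.

Lemma counter_keep n t : counter n t ->
  counter n (move_head Stay (write t (scan t))).
Proof.
move=> [a [b ->]]; exists a; case: n => [|n]; last by exists b.
by case: b => [|b]; [exists 1 | exists b.+1].
Qed.

Lemma counter_scan n t : counter n t -> (scan t == stroke) = (0 < n).
Proof. by move=> [a [b ->]]; case: n => [|n]; rewrite /scan /= ?eqxx//; case: b. Qed.

(** A new stroke is put in front: one step to the left, then one to write. *)
Lemma counter_inc n t : counter n t -> counter n.+1
 (move_head Stay (write (move_head MoveLeft (write t (scan t))) stroke)).
Proof.
move=> [a [b ->]]; exists a.-1; case: n => [|n]; last first.
  by exists b; case: a.
by case: b => [|b]; [exists 1 | exists b.+1]; case: a.
Qed.

Lemma counter_dec n t : counter n.+1 t ->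
  counter n (move_head MoveRight (write t None)).
Proof. by move=> [a [b ->]]; exists a.+1, b. Qed.

Lemma holds_keep s t : holds s t -> holds s (move_head Stay (write t (scan t))).
Proof.
move=> [b]; rewrite /scan => h; rewrite /holds /= /scan h.
case: s h => [|c s] h /=; last by exists b.
by case: b h => [|b] h; [exists 1 | exists b.+1].
Qed.

Lemma holds_next c s t : holds (c :: s) t ->
  holds s (move_head MoveRight (write t (scan t))).
Proof. by move=> [b h]; exists b; rewrite /= h. Qed.

Lemma holds_scan c s t : holds s t ->
  (scan t == Some (inl c)) = (head Stop s == c) && (s != [::]).
Proof.
rewrite /scan => -[b ->]; case: s => [|d s]; first by case: b; rewrite andbF.
by rewrite /= andbT.
Qed.

Lemma represents_ext m m' s (t : tapes) : m =1 m' ->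
  represents m s t -> represents m' s t.
Proof. by move=> E [h1 h2]; split=> // i; rewrite -E; exact: h1. Qed.

Lemma represents_keep m s (t : tapes) : represents m s t ->
  represents m s (perform t (keep (scanned t))).
Proof.
move=> [h1 h2]; split=> [i /h1 h|]; rewrite /perform /= ffunE.
  exact: counter_keep.
exact: holds_keep.
Qed.

Lemma inord_max r : r <= k -> (inord r : 'I_k.+2) != ord_max.
Proof.
by move=> h; apply/eqP => /(congr1 val) /=; rewrite inordK; lia.
Qed.

Definition at_tape (r : nat) (g : option symb -> option symb * move)
    (f : {ffun 'I_k.+2 -> option symb}) : 'I_k.+2 -> option symb * move :=
  fun i => if i == inord r then g (f i) else keep f i.

Definition act_on r g : component k := atom (at_tape r g).

Definition incc r := seqc (act_on r (fun x => (x, MoveLeft)))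
  (act_on r (fun _ => (stroke, Stay))).

Definition decc r := act_on r (fun _ => (None, MoveRight)).

Definition nextc := act_on k.+1 (fun x => (x, MoveRight)).

Definition loopc r (P : component k) :=
  whilec (fun f => f (inord r) == stroke) P.

Definition scanc c (P : component k) :=
  whilec (fun f => f ord_max == Some (inl c)) P.

Lemma perform_on r g (t : tapes) i : perform t (at_tape r g (scanned t)) i
 = if i == inord r then move_head (g (scan (t i))).2
                          (write (t i) (g (scan (t i))).1)
   else move_head Stay (write (t i) (scan (t i))).
Proof. by rewrite /perform /at_tape /keep !ffunE; case: ifP. Qed.

Lemma triple_inc m s r : r <= k ->
  triple (represents m s) (incc r) (represents (upd m r (m r).+1) s).
Proof.
move=> hr; have hr' : r < k.+2 by lia.
pose lifted (t : tapes) := forall i : 'I_k.+2, i != ord_max ->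
  if i == inord r then counter (m i).+1 (move_head Stay (write (t i) stroke))
  else counter (m i) (t i).
apply: (@triple_seq _ _ (fun t => lifted t /\ holds s (t ord_max))).
  apply: triple_atom => t [h1 h2]; split=> [i hi|].
    rewrite perform_on; have [E|ne] := eqVneq i (inord r).
      exact: counter_inc (h1 i hi).
    exact: counter_keep (h1 i hi).
  by rewrite perform_on eq_sym (negPf (inord_max hr)); exact: holds_keep.
apply: triple_atom => t [h1 h2]; split=> [i hi|].
  rewrite perform_on; have := h1 i hi.
  rewrite /upd -[i == inord r](inj_eq val_inj) /= inordK//.
  by case: ifP => [/eqP ->//|_]; exact: counter_keep.
by rewrite perform_on eq_sym (negPf (inord_max hr)); exact: holds_keep.
Qed.

Lemma triple_dec m s r : r <= k -> 0 < m r ->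
  triple (represents m s) (decc r) (represents (upd m r (m r).-1) s).
Proof.
move=> hr m0; have hr' : r < k.+2 by lia.
apply: triple_atom => t [h1 h2]; split=> [i hi|].
  rewrite perform_on; have := h1 i hi.
  rewrite /upd -[i == inord r](inj_eq val_inj) /= inordK//.
  case: ifP => [/eqP -> h|_]; last exact: counter_keep.
  by apply: counter_dec; rewrite prednK.
by rewrite perform_on eq_sym (negPf (inord_max hr)); exact: holds_keep.
Qed.

Lemma triple_next m c s :
  triple (represents m (c :: s)) nextc (represents m s).
Proof.
have E : inord k.+1 = ord_max :> 'I_k.+2 by apply: val_inj; rewrite /= inordK.
apply: triple_atom => t [h1 h2]; split=> [i hi|].
  by rewrite perform_on E (negPf hi); apply: counter_keep; exact: h1.
by rewrite perform_on E eqxx; exact: holds_next h2.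
Qed.

(** The family [m] describes the memory by the current content of the tested
register; it only has to be meaningful up to the initial content [N]. *)
Lemma triple_loop (m : nat -> nat -> nat) s r P N : r <= k ->
  (forall n, m n r = n) ->
  (forall n, n < N ->
     triple (represents (m n.+1) s) P (represents (m n) s)) ->
  triple (represents (m N) s) (loopc r P) (represents (m 0) s).
Proof.
move=> hr hm hP.
pose Inv n (t : tapes) := n <= N /\ represents (m n) s t.
apply: (@triple_conseq _ (Inv N) _ (Inv 0)) => [||t []//] //.
apply: triple_while => [n t [_ [h1 _]]|n t [nN h]|n t [nN h]].
- rewrite ffunE; have := h1 _ (inord_max hr).
  by rewrite inordK ?hm; [exact: counter_scan | lia].
- by split=> //; exact: represents_keep.
by have [t' e h'] := hP n nN t h; exists t' => //; split=> //; exact: ltnW.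
Qed.

(** Reads a block of [N] symbols [c], up to the different symbol that delimits it. *)
Lemma triple_scan (m : nat -> nat -> nat) c s P N :
  (forall n, n < N -> triple (represents (m n.+1) (nseq n.+1 c ++ s)) P
     (represents (m n) (nseq n c ++ s))) ->
  s != [::] -> head Stop s != c ->
  triple (represents (m N) (nseq N c ++ s)) (scanc c P) (represents (m 0) s).
Proof.
move=> hP s0 sc.
pose Inv n (t : tapes) := n <= N /\ represents (m n) (nseq n c ++ s) t.
apply: (@triple_conseq _ (Inv N) _ (Inv 0)) => [||t []//] //.
apply: triple_while => [n t [_ [_ h2]]|n t [nN h]|n t [nN h]].
- rewrite ffunE (holds_scan _ h2); case: n {h2} => [|n] /=; last by rewrite eqxx.
  by rewrite (negPf sc).
- by split=> //; exact: represents_keep.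
by have [t' e h'] := hP n nN t h; exists t' => //; split=> //; exact: ltnW.
Qed.

End Registers.

(** * Programs as memory transformers *)
Section Transformers.
Variable k : nat.

(** The unread part of the answer tape is arbitrary and left in place. *)
Definition transforms (m : nat -> nat) (P : component k) (m' : nat -> nat) :=
  forall s, triple (represents m s) P (represents m' s).

Lemma transforms_ext m m' m'' P : m' =1 m'' ->
  transforms m P m' -> transforms m P m''.
Proof.
by move=> E h s; apply: (triple_post (h s)) => // t; exact: represents_ext.
Qed.

Lemma transforms_seq m m' m'' P Q :
  transforms m P m' -> transforms m' Q m'' -> transforms m (seqc P Q) m''.
Proof. by move=> h1 h2 s; apply: triple_seq (h1 s) (h2 s). Qed.

Lemma transforms_inc m r : r <= k -> transforms m (incc k r) (upd m r (m r).+1).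
Proof. by move=> hr s; exact: triple_inc. Qed.

Lemma transforms_dec m r : r <= k -> 0 < m r ->
  transforms m (decc k r) (upd m r (m r).-1).
Proof. by move=> hr m0 s; exact: triple_dec. Qed.

Lemma transforms_loop (m : nat -> nat -> nat) r P N : r <= k ->
  (forall n, m n r = n) ->
  (forall n, n < N -> transforms (m n.+1) P (m n)) ->
  transforms (m N) (loopc r P) (m 0).
Proof. by move=> hr hm hP s; apply: triple_loop => // n /hP. Qed.

Definition skipc := atom (@keep k).

Lemma transforms_skip m : transforms m skipc m.
Proof. by move=> s; apply: triple_atom => t; exact: represents_keep. Qed.

Definition clearc r := loopc r (decc k r).

Lemma transforms_clear m r : r <= k -> transforms m (clearc r) (upd m r 0).
Proof.
move=> hr; have -> : m = upd m r (m r).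
  by apply/funext => i; rewrite /upd; case: eqP => // ->.
move: (m r) => N; apply: transforms_ext; last first.
  apply: (@transforms_loop (fun n => upd m r n) r _ N) => //.
    by move=> n; rewrite /upd eqxx.
  move=> n _; apply: transforms_ext; last first.
    by apply: transforms_dec => //; rewrite /upd eqxx.
  by move=> i; rewrite /upd eqxx /=; case: eqP.
by move=> i; rewrite /upd; case: eqP.
Qed.

Definition addc r r' := loopc r (seqc (decc k r) (incc k r')).

Lemma transforms_add m r r' : r <= k -> r' <= k -> r != r' ->
  transforms m (addc r r') (upd (upd m r' (m r' + m r)) r 0).
Proof.
move=> hr hr' rr.
pose f n := upd (upd m r' (m r' + (m r - n))) r n.
have -> : m = f (m r).
  apply/funext => i; rewrite /f /upd; case: eqP => [->//|_].
  by case: eqP => // ->; lia.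
have -> : upd (upd (f (m r)) r' (f (m r) r' + f (m r) r)) r 0 = f 0.
  apply/funext => i; rewrite /f /upd eqxx [r' == r]eq_sym (negPf rr) eqxx.
  by case: eqP => // _; case: eqP => // _; lia.
apply: transforms_loop => //; first by move=> n; rewrite /f /upd eqxx.
move=> n nN; apply: (@transforms_ext _ (upd (upd (f n.+1) r n) r'
    (f n.+1 r').+1)).
  move=> i; rewrite /f /upd [r' == r]eq_sym (negPf rr) eqxx.
  case: eqP => [->|_].
    by rewrite eq_sym (negPf rr); lia.
  by case: eqP.
apply: transforms_seq; first apply: transforms_dec => //.
  by rewrite /f /upd eqxx.
apply: transforms_ext; last exact: transforms_inc.
by move=> i; rewrite /f /upd eqxx /= [r' == r]eq_sym (negPf rr) eqxx.
Qed.

(** Unary registers can only be moved, so that a copy is made by moving [r] to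
two registers and then one of these back to [r]. *)
Definition dupc r s t :=
  loopc r (seqc (decc k r) (seqc (incc k s) (incc k t))).

Definition copyc r s t := seqc (dupc r s t) (addc t r).

Lemma transforms_copy m r s t : [&& r <= k, s <= k & t <= k] ->
  uniq [:: r; s; t] -> m s = 0 -> m t = 0 ->
  transforms m (copyc r s t) (upd m s (m r)).
Proof.
move=> /and3P[hr hs ht].
rewrite /= !inE negb_or andbT => /andP[/andP[/negPf rs /negPf rt] /negPf st].
have sr : (s == r) = false by rewrite eq_sym.
have tr : (t == r) = false by rewrite eq_sym.
have ts : (t == s) = false by rewrite eq_sym.
move=> ms mt; pose f n := upd (upd (upd m t (m r - n)) s (m r - n)) r n.
have -> : m = f (m r).
  apply/funext => i; rewrite /f /upd; case: eqP => [->//|_].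
  by case: eqP => [->|_]; [lia | case: eqP => // ->; lia].
have -> : f (m r) r = m r by rewrite /f /upd eqxx.
apply: (@transforms_seq _ (f 0)).
  apply: transforms_loop => // [n|n nN]; first by rewrite /f /upd eqxx.
  apply: (@transforms_ext _ (upd (upd (upd (f n.+1) r n) s (f n.+1 s).+1)
     t (f n.+1 t).+1)).
    move=> i; rewrite /f /upd !eqxx ?sr ?tr ?ts.
    case: (eqVneq i r) => [->|_]; first by rewrite rs rt.
    case: (eqVneq i s) => [->|_]; first by rewrite st; lia.
    by case: (eqVneq i t) => [_|_ //]; lia.
  apply: transforms_seq; first by apply: transforms_dec => //; rewrite /f /upd eqxx.
  apply: transforms_seq; first exact: transforms_inc.
  apply: transforms_ext; last exact: transforms_inc.
  by move=> i; rewrite /f /upd /= ?eqxx ?sr ?tr ?ts.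
apply: transforms_ext; last by apply: transforms_add => //; rewrite tr.
move=> i; rewrite /f /upd !eqxx ?sr ?tr ?ts ?rt.
case: (eqVneq i t) => [->|it]; first by rewrite ts tr; lia.
case: (eqVneq i r) => [->|ir]; first by rewrite rs; lia.
by case: (eqVneq i s) => [_|//]; lia.
Qed.

End Transformers.

(** * Computable functions *)
Section Computable.

(** [f] can be computed from the functions [vars]: for any registers [args] that
hold their values at [x], some component writes [f x] into the first free
register [s] and restores everything else. The domain [T] is arbitrary and the
arguments are found by address, so that a context can be enlarged by a bound
variable without changing the program. The number [h] of scratch registers is
fixed before the total number [k] of registers, because the latter is a parameter
of the machine. *)
Definition computable T (vars : seq (T -> nat)) (f : T -> nat) : Prop :=
  exists h, forall k s args, s + h <= k -> size args = size vars ->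
    all (fun a => a < s) args ->
  exists P : component k, forall m x, (forall i, s <= i -> m i = 0) ->
    map m args = map (fun v => v x) vars -> transforms m P (upd m s (f x)).

(** The context [T] enlarged by one natural number, as under a binder. *)
Definition extend T (vars : seq (T -> nat)) : seq (T * nat -> nat) :=
  snd :: map (fun v u => v u.1) vars.

Variables (T : Type) (vars : seq (T -> nat)).

Lemma computable_ext f g : f =1 g -> computable vars f -> computable vars g.
Proof. by move=> /funext ->. Qed.

Lemma computable_var i : i < size vars -> computable vars (nth (fun _ => 0) vars i).
Proof.
move=> hi; exists 2 => k s args hk sz hargs; exists (copyc k (nth 0 args i) s s.+1).
move=> m x hm E.
have h : nth 0 args i < s by apply: (all_nthP 0 hargs); rewrite sz.
have -> : nth (fun _ => 0) vars i x = m (nth 0 args i).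
  by rewrite -(nth_map _ 0 m) ?sz// E (nth_map (fun _ => 0)).
apply: transforms_copy; rewrite ?hm//; [lia|].
by rewrite /= !inE; lia.
Qed.

Lemma computable_zero : computable vars (fun _ => 0).
Proof.
exists 0 => k s args _ _ _; exists (skipc k) => m x hm _.
apply: transforms_ext; last exact: transforms_skip.
by move=> i; rewrite /upd; case: eqP => // ->; rewrite hm.
Qed.

Lemma computable_succ f : computable vars f -> computable vars (fun x => (f x).+1).
Proof.
move=> [h H]; exists h => k s args hk sz ha; have [P HP] := H k s args hk sz ha.
exists (seqc P (incc k s)) => m x hm E.
apply: transforms_seq (HP _ _ hm E) _.
apply: transforms_ext; last by apply: transforms_inc; lia.
by move=> i; rewrite /upd eqxx; case: eqP.
Qed.

Lemma computable_weak (f : T -> nat) : computable vars f ->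
  computable (extend vars) (fun u => f u.1).
Proof.
move=> [h H]; exists h => k s [//|a args] hk /= [+] /andP[_ ha].
rewrite size_map => sz.
have [P HP] := H k s args hk sz ha; exists P => m x hm [_ E].
by apply: HP => //; rewrite E -map_comp.
Qed.

Lemma map_upd_out m s v (args : seq nat) : all (fun a => a < s) args ->
  map (upd m s v) args = map m args.
Proof.
move=> /allP h; apply/eq_in_map => a /h; rewrite /upd; case: eqP => // ->.
by rewrite ltnn.
Qed.

(** Primitive recursion. Register [s] counts down the remaining rounds, [s.+1]
counts up the rounds done, [s.+2] accumulates, and the step function leaves its
value in [s.+3]. *)
Lemma computable_rec n f (g : T * nat * nat -> nat) :
  computable vars n -> computable vars f -> computable (extend (extend vars)) g ->
  computable vars (fun x => iteri (n x) (fun i a => g (x, i, a)) (f x)).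
Proof.
move=> [hn Hn] [hf Hf] [hg Hg].
exists (maxn hn (maxn (hf.+2) (hg.+4))) => k s args hk sz ha.
have [|N HN] := Hn k s args _ sz ha; first by lia.
have [||P HP] := Hf k s.+2 args _ sz _; [lia| |].
  by apply: sub_all ha => a /=; lia.
have [|||Q HQ] := Hg k s.+3 (s.+2 :: s.+1 :: args) _ _ _; [lia| | |].
- by rewrite /= !size_map sz.
- by rewrite /= !leqnn /= ltnS leqnSn /=; apply: sub_all ha => a /=; lia.
exists (seqc N (seqc P (seqc (loopc s (seqc (decc k s) (seqc Q (seqc
  (clearc k s.+2) (seqc (addc k s.+3 s.+2) (incc k s.+1))))))
  (seqc (clearc k s.+1) (addc k s.+2 s))))) => m x hm E.
have e1 : (s.+1 == s) = false by lia.
have e2 : (s.+2 == s) = false by lia.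
have e3 : (s.+3 == s) = false by lia.
have e4 : (s.+2 == s.+1) = false by lia.
have e5 : (s.+3 == s.+1) = false by lia.
have e6 : (s.+3 == s.+2) = false by lia.
have e1' : (s == s.+1) = false by lia.
have e2' : (s == s.+2) = false by lia.
have e3' : (s == s.+3) = false by lia.
have e4' : (s.+1 == s.+2) = false by lia.
have e5' : (s.+1 == s.+3) = false by lia.
have e6' : (s.+2 == s.+3) = false by lia.
(* the accumulator after [i] rounds *)
pose G i := iteri i (fun i a => g (x, i, a)) (f x).
(* the memory when [c] rounds remain *)
pose M c := upd (upd (upd m s c) s.+1 (n x - c)) s.+2 (G (n x - c)).
have MargsE c : [seq M c i | i <- args] = [seq v x | v <- vars].
  rewrite /M !map_upd_out //; apply: sub_all ha => a /=; lia.
apply: transforms_seq (HN _ _ hm E) _.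
apply: transforms_seq.
  apply: (HP _ x) => [i hi|]; last by rewrite map_upd_out.
  by rewrite /upd; case: eqP => [|_]; [lia|apply: hm; lia].
rewrite -/(G 0).
have -> : upd (upd m s (n x)) s.+2 (f x) = M (n x).
  apply/funext => i; rewrite /M /upd subnn /=.
  case: eqP => // _; case: (eqVneq i s.+1) => // ->.
  by rewrite e1 hm.
apply: (@transforms_seq _ _ (M 0)).
  apply: transforms_loop; [lia|by move=> c; rewrite /M /upd e2' e1' eqxx|].
  move=> c cn.
  apply: transforms_seq.
    by apply: transforms_dec; [lia|rewrite /M /upd e2' e1' eqxx].
  have -> : (M c.+1 s).-1 = c by rewrite /M /upd e2' e1' eqxx.
  apply: transforms_seq.
    apply: (HQ _ (x, n x - c.+1, G (n x - c.+1))) => [i hi|].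
      rewrite /M /upd; do ![case: eqP => [|_]; first lia].
      by apply: hm; lia.
    rewrite /= map_upd_out // MargsE -!map_comp; congr [:: _, _ & _].
      by rewrite /M /upd e2 eqxx.
    by rewrite /M /upd e1 e4' eqxx.
  apply: transforms_seq; first by apply: transforms_clear; lia.
  apply: transforms_seq; first by apply: transforms_add; lia.
  apply: transforms_ext; last by apply: transforms_inc; lia.
  move=> i; rewrite /M /upd !eqxx ?e1 ?e2 ?e3 ?e4 ?e5 ?e6 ?e1' ?e2' ?e3' ?e4' ?e5' ?e6'.
  have -> : n x - c = (n x - c.+1).+1 by lia.
  case: (eqVneq i s) => [->|is0].
    by rewrite ?e1' ?e2' ?e3' .
  case: (eqVneq i s.+1) => [->|is1].
    by rewrite ?e4' ?e5'.
  case: (eqVneq i s.+2) => [->|is2].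
    by rewrite e6' /= add0n.
  case: (eqVneq i s.+3) => [->|is3 //].
  by rewrite hm//; lia.
apply: transforms_seq; first by apply: transforms_clear; lia.
apply: transforms_ext; last by apply: transforms_add; lia.
move=> i; rewrite /M /upd !eqxx ?e1 ?e2 ?e4 ?e1' ?e2' ?e4' subn0.
case: (eqVneq i s) => [->|is0]; first by rewrite e2' add0n.
case: (eqVneq i s.+1) => [->|is1]; first by rewrite e4' hm.
case: (eqVneq i s.+2) => [->|is2 //].
by rewrite hm//; lia.
Qed.

End Computable.

(** * Reading an answer of the oracle *)
Section Parsing.
Variable k : nat.

Definition tallyc c r := scanc c (seqc (incc k r) (nextc k)).

Lemma triple_tally m c r s N : r <= k -> s != [::] -> head Stop s != c ->
  triple (represents m (nseq N c ++ s)) (tallyc c r)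
    (represents (upd m r (m r + N)) s).
Proof.
move=> hr s0 sc; pose f n := upd m r (m r + (N - n)).
have -> : upd m r (m r + N) = f 0 by rewrite /f subn0.
have {1}-> : m = f N.
  by apply/funext => i; rewrite /f /upd subnn addn0; case: eqP => // ->.
apply: triple_scan => // n nN; apply: triple_seq; last exact: triple_next.
apply: (triple_post (triple_inc hr)) => // t; apply: represents_ext => i.
by rewrite /f /upd eqxx; case: eqP => // _; lia.
Qed.

Definition ratc r :=
  seqc (tallyc Minus r) (seqc (tallyc One r.+1) (seqc (nextc k)
    (seqc (tallyc One r.+2) (nextc k)))).

(** What three registers hold after a rational has been read. *)
Definition rat_code (q : rat) : seq nat :=
  [:: (numq q < 0)%R : nat; `|numq q|%N; `|denq q|%N].

Fixpoint parsec r n : component k :=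
  if n is n'.+1 then seqc (ratc r) (parsec r.+3 n') else skipc k.

Definition install r (vs : seq nat) (m : nat -> nat) : nat -> nat :=
  fun i => if i < r then m i else nth 0 vs (i - r).

Lemma triple_rat m r s q : r.+2 <= k -> (forall i, r <= i -> m i = 0) ->
  triple (represents m (write_rat q ++ s)) (ratc r)
    (represents (install r (rat_code q) m) s).
Proof.
move=> hr hm; rewrite /write_rat -!catA.
apply: triple_seq.
  apply: triple_tally; [lia|by case: `|numq q|%N|].
  by apply/eqP; case: `|numq q|%N.
apply: triple_seq; first by apply: triple_tally; [lia| |exact/eqP].
apply: triple_seq; first exact: triple_next.
apply: triple_seq; first by apply: triple_tally; [lia| |exact/eqP].
apply: (triple_post (@triple_next _ _ _ _)) => // t; apply: represents_ext => i.
rewrite /install /upd.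
have [ir|ir] := ltnP i r.
  by do ![case: eqP => [?|_]; first lia].
have [->|h0] := eqVneq i r.+2.
  have -> : r.+2 - r = 2 by lia.
  do ![case: eqP => [|_]; first lia].
  by rewrite hm //; lia.
have [->|h1] := eqVneq i r.+1.
  have -> : r.+1 - r = 1 by lia.
  do ![case: eqP => [|_]; first lia].
  by rewrite hm //; lia.
have [->|h2] := eqVneq i r; first by rewrite subnn hm.
by rewrite hm // nth_default //=; lia.
Qed.

Lemma triple_parse m r qs : r + 3 * size qs <= k.+1 ->
  (forall i, r <= i -> m i = 0) ->
  triple (represents m (flatten [seq write_rat q | q <- qs]))
    (parsec r (size qs))
    (represents (install r (flatten [seq rat_code q | q <- qs]) m) [::]).
Proof.
elim: qs m r => [|q qs IH] m r /= hr hm.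
  apply: (triple_post (@transforms_skip _ _ _)) => // t; apply: represents_ext => i.
  by rewrite /install nth_nil; case: ltnP => // /hm.
apply: triple_seq; first by apply: triple_rat => //; lia.
apply: (triple_post (IH (install r (rat_code q) m) r.+3 _ _)).
- lia.
- by move=> i hi; rewrite /install ltnNge (leq_trans _ hi) ?nth_default //=; lia.
move=> t; apply: represents_ext => i; rewrite /install.
have [h1|h1] := ltnP i r.+3.
  case: ltnP => // h2.
  have : i - r < 3 by lia.
  by case: (i - r) => [|[|[|]]].
rewrite ltnNge (leq_trans _ h1) /=; last by lia.
have -> : i - r = (i - r.+3).+3 by lia.
by [].
Qed.

End Parsing.

(** * The search machine *)
Section Semidecision.
Variable l : nat.

(** The precision of the query together with the answer to it. *)
Definition input : Type := (nat * 'rV[rat]_l)%type.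

Definition input_vars : seq (input -> nat) :=
  fst :: flatten [seq [:: (fun x : input => (numq (x.2 0%R j) < 0)%R : nat);
                          (fun x : input => `|numq (x.2 0%R j)|%N);
                          (fun x : input => `|denq (x.2 0%R j)|%N)]
                 | j <- enum 'I_l].

Lemma input_varsE x v : [seq f (x, v) | f <- input_vars] =
  x :: flatten [seq rat_code q | q <- [seq v 0%R j | j <- enum 'I_l]].
Proof.
rewrite /= map_flatten; congr (_ :: flatten _); rewrite -!map_comp.
by apply: eq_map.
Qed.

Lemma size_input_vars : size input_vars = (3 * l).+1.
Proof.
rewrite /= size_flatten /shape -map_comp.
by rewrite (eq_map (g := fun=> 3)) // sumnE big_map big_const_seq
  count_predT size_enum_ord iter_addn_0.
Qed.

Section Machine.
Variables (k : nat) (P : component k).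
Local Notation s := (3 * l).+1.

Fixpoint clearsc r n : component k :=
  if n is n'.+1 then seqc (clearc k r) (clearsc r.+1 n') else skipc k.

Definition bodyc := seqc (parsec k 1 l) P.
Definition cleanupc := seqc (clearsc 1 (3 * l)) (incc k 0).

(** A machine enters its query state without a memory of where it came from, so
that there is a single query, at the head of the main loop; the query state is
also the initial one. The body and the cleanup are components, between which
[search_test] decides whether to stop. *)
Definition search_state : finType :=
  (option bool + (cp_state bodyc + cp_state cleanupc))%type.

Definition search_query : search_state := inl None.
Definition search_test : search_state := inl (Some false).
Definition search_halt : search_state := inl (Some true).

Definition search_trans (q : search_state)
    (f : {ffun 'I_k.+2 -> option symb}) :
    search_state * ('I_k.+2 -> option symb * move) :=
  match q with
  | inl None => (search_query, keep f)
  | inl (Some b) => (if b || (f (inord s) == stroke) then search_halt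
                     else inr (inr (cp_start cleanupc)), keep f)
  | inr (inl q) => let r := cp_trans q f in
      (if r.1 is Some q' then inr (inl q') else search_test, r.2)
  | inr (inr q) => let r := cp_trans q f in
      (if r.1 is Some q' then inr (inr q') else search_query, r.2)
  end.

Definition search_machine : oracle_machine :=
  @OracleMachine search_state void k search_query search_halt search_query
    (inr (inl (cp_start bodyc))) search_trans.

Variable phi : nat -> 'rV[rat]_l.
Local Notation step := (@step search_machine l phi).
Local Notation conf := (@Config search_machine).

Lemma step_state q t r : q != search_halt -> q != search_query ->
  search_trans q (scanned t) = r -> step (conf q t) = conf r.1 (perform t r.2).
Proof. by rewrite /step /= => /negPf -> /negPf -> <-. Qed.

Lemma run_body q t t' : exec q t t' ->
  exists n, iter n.+1 step (conf (inr (inl q)) t) = conf search_test t'.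
Proof.
elim=> {q t t'} [q t a E|q t q' a t' E _ [n IH]].
  by exists 0; apply: (@step_state _ _ (_, _)); rewrite // /search_trans E.
exists n.+1; rewrite iterSr -IH; congr (iter _ _ _).
by apply: (@step_state _ _ (_, _)); rewrite // /search_trans E.
Qed.

Lemma run_cleanup q t t' : exec q t t' ->
  exists n, iter n.+1 step (conf (inr (inr q)) t) = conf search_query t'.
Proof.
elim=> {q t t'} [q t a E|q t q' a t' E _ [n IH]].
  by exists 0; apply: (@step_state _ _ (_, _)); rewrite // /search_trans E.
exists n.+1; rewrite iterSr -IH; congr (iter _ _ _).
by apply: (@step_state _ _ (_, _)); rewrite // /search_trans E.
Qed.

Definition counting x : nat -> nat := upd (fun=> 0) 0 x.

Lemma query_counter n t : counter n t -> @query_value search_machine t = n.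
Proof.
move=> [a [b ->]]; rewrite /query_value /= !count_cat !count_nseq /=.
by rewrite eqxx mul1n !mul0n addn0.
Qed.

Lemma transforms_clears m r n : r + n <= k.+1 ->
  transforms m (clearsc r n) (fun i => if r <= i < r + n then 0 else m i).
Proof.
elim: n m r => [|n IH] m r hr /=.
  apply: transforms_ext; last exact: transforms_skip.
  by move=> i; case: ifP => //; lia.
apply: transforms_seq; first by apply: transforms_clear; lia.
apply: transforms_ext; last by apply: IH; lia.
move=> i; rewrite /upd; case: (eqVneq i r) => [->|h].
  by case: ifP => //; case: ifP => //; lia.
by case: ifP => h1; case: ifP => h2 //; exfalso; lia.
Qed.

Variable F : input -> bool.
Hypothesis hk : s <= k.
Hypothesis HP : forall m x, (forall i, s <= i -> m i = 0) ->
  map m (iota 0 s) = map (fun v => v x) input_vars ->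
  transforms m P (upd m s (F x)).

(** One turn of the main loop. It takes at least one step, which is what rules
out halting when no number is accepted. *)
Lemma search_round (x : nat) ss t : represents (counting x) ss t ->
  exists n t' ss', iter n.+1 step (conf search_query t) =
    conf (if F (x, phi x) then search_halt else search_query) t' /\
    (~~ F (x, phi x) -> represents (counting x.+1) ss' t').
Proof.
move=> ht; pose qs := [seq phi x 0%R j | j <- enum 'I_l].
have sqs : size qs = l by rewrite size_map size_enum_ord.
pose t1 : 'I_k.+2 -> tape symb := fun i =>
  if i == ord_max then reply_tape search_machine (write_vec (phi x)) else t i.
have E1 : step (conf search_query t) = conf (inr (inl (cp_start bodyc))) t1.
  rewrite /step /= /query_step /=; congr Config; apply/funext => i.
  rewrite (@query_counter x) //.
  have /(_ _) := ht.1 ord0; rewrite /counting /upd /=; exact.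
have h1 : represents (counting x) (flatten [seq write_rat q | q <- qs]) t1.
  split=> [i hi|]; first by rewrite /t1 (negPf hi); exact: ht.1.
  by rewrite /t1 eqxx; exists 0; rewrite cats0 /write_vec /qs -map_comp.
pose m1 := install 1 (flatten [seq rat_code q | q <- qs]) (counting x).
have szf : size (flatten [seq rat_code q | q <- qs]) = 3 * l.
  have /(congr1 size) := input_varsE x (phi x).
  by rewrite size_map size_input_vars /= => -[].
have hbody : triple (represents (counting x) (flatten [seq write_rat q | q <- qs]))
    bodyc (represents (upd m1 s (F (x, phi x))) [::]).
  apply: triple_seq.
    rewrite -{1}sqs; apply: triple_parse; first by rewrite sqs; lia.
    by move=> i hi; rewrite /counting /upd; case: eqP => //; lia.
  apply: HP => [i hi|].
    by rewrite /m1 /install ltnNge (leq_trans _ hi) //= nth_default // szf; lia.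
  rewrite input_varsE -/qs; apply: (@eq_from_nth _ 0).
    by rewrite size_map size_iota /= szf.
  move=> i; rewrite size_map size_iota => hi.
  rewrite (nth_map 0) ?size_iota // nth_iota // add0n /m1 /install.
  by case: i hi => [|i] hi //=; rewrite subn1.
have [t2 /run_body [n2 E2] h2] := hbody t1 h1.
pose t3 := perform t2 (keep (scanned t2)).
have h3 : represents (upd m1 s (F (x, phi x))) [::] t3 by exact: represents_keep.
have E3 : step (conf search_test t2) =
    conf (if F (x, phi x) then search_halt else inr (inr (cp_start cleanupc))) t3.
  apply: (@step_state _ _ (_, _)) => //; rewrite /search_trans.
  rewrite [scanned t2 _]ffunE (counter_scan (h2.1 _ (inord_max hk))).
  by rewrite inordK ?/upd ?eqxx; [case: (F _)|lia].
have E123 : iter n2.+3 step (conf search_query t) =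
    conf (if F (x, phi x) then search_halt else inr (inr (cp_start cleanupc))) t3.
  by rewrite -E3 -E2 iterS iterSr E1.
case: ifP h3 E123 => [Ft|Ff] h3 E123.
  by exists n2.+2, t3, [::].
have hclean : triple (represents (upd m1 s false) [::]) cleanupc
    (represents (counting x.+1) [::]).
  apply: (@transforms_seq _ _ (counting x)); last first.
    apply: transforms_ext; last exact: transforms_inc.
    by move=> i; rewrite /counting /upd eqxx; case: eqP.
  apply: transforms_ext; last by apply: transforms_clears; lia.
  move=> i; rewrite /upd /counting /m1 /install /upd.
  case: ifP => [|hi]; first by case: eqP => //; lia.
  case: (eqVneq i s) => [->//|is0]; case: ltnP => // i1.
  by rewrite nth_default ?szf; [case: eqP => //; lia|lia].
have [t4 /run_cleanup [n4 E4] h4] := hclean t3 h3.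
exists (n4 + n2.+3), t4, [::]; split=> //.
by rewrite -addSn iterD E123.
Qed.

(** The machine is deterministic and visits the query state with each [x] in
turn, at a time not smaller than [x], until some [x] is accepted. As the halting
state is absorbing, it is not reached if this goes on for ever. *)
Lemma search_halts : halts search_machine phi <-> exists x, F (x, phi x).
Proof.
have init : @represents k (counting 0) [::] (fun=> blank_tape symb).
  split=> [i hi|]; last by exists 0.
  by exists 0, 0; rewrite /counting /upd; case: (val i == 0).
have reach x : (forall y, y < x -> ~~ F (y, phi y)) -> exists n t ss,
    iter (x + n) step (init_config search_machine) = conf search_query t /\
    represents (counting x) ss t.
  elim: x => [|x IH] hx; first by exists 0, (fun=> blank_tape symb), [::].
  have [|n [t [ss [E h]]]] := IH; first by move=> y yx; apply: hx; exact: ltnW.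
  have [n' [t' [ss' [E' h']]]] := search_round h.
  have nF := hx x (leqnn _); rewrite (negPf nF) in E' h'.
  exists (n' + n), t', ss'; split; last exact: h'.
  have -> : x.+1 + (n' + n) = n'.+1 + (x + n) by lia.
  by rewrite iterD E E'.
split=> [[t ht]|hF].
  apply/not_existsP => nF.
  have [|n [t' [ss [E h]]]] := reach t; first by move=> y _; apply/negP; exact: nF.
  suff : cf_state (iter (t + n) step (init_config search_machine)) = search_halt.
    by rewrite E.
  rewrite addnC iterD; elim: n {E} => //= n IH.
  by rewrite /step IH (eqxx search_halt).
case: (ex_minnP hF) => x Fx xmin.
have [|n [t [ss [E h]]]] := reach x.
  by move=> y; apply: contraTN => /xmin; rewrite -leqNgt.
have [n' [t' [ss' [E' _]]]] := search_round h.
exists (n'.+1 + (x + n)); rewrite iterD E E'.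
by rewrite Fx.
Qed.

End Machine.

Theorem semidecidable (F : input -> bool) :
  computable input_vars (fun x => F x : nat) ->
  exists M : oracle_machine, forall phi : nat -> 'rV[rat]_l,
    halts M phi <-> exists x, F (x, phi x).
Proof.
move=> [h H]; have [|||P HP] := H ((3 * l).+1 + h) (3 * l).+1 (iota 0 (3 * l).+1).
- by [].
- by rewrite size_iota size_input_vars.
- by apply/allP => a; rewrite mem_iota.
by exists (search_machine P) => phi; apply: search_halts => //; lia.
Qed.

End Semidecision.

(** * Computable arithmetic and decidable predicates *)
Definition decides T (vars : seq (T -> nat)) (p : pred T) :=
  computable vars (fun x => p x : nat).

Section Iteration.
Variables (T : Type) (vars : seq (T -> nat)).
Implicit Types f g : T -> nat.

Lemma computable_const n : computable vars (fun _ => n).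
Proof.
by elim: n => [|n]; [exact: computable_zero|exact: computable_succ].
Qed.

Lemma computable_iteri n f (g : T * nat * nat -> nat) h :
  computable vars n -> computable vars f -> computable (extend (extend vars)) g ->
  (forall x, iteri (n x) (fun i a => g (x, i, a)) (f x) = h x) ->
  computable vars h.
Proof. by move=> hn hf hg /computable_ext; apply; exact: computable_rec. Qed.

Lemma computable_last : computable (extend vars) snd.
Proof. exact: (@computable_var _ (extend vars) 0). Qed.

End Iteration.

Section Addition.
Variables (T : Type) (vars : seq (T -> nat)).
Implicit Types f g : T -> nat.

Lemma computable_add f g : computable vars f -> computable vars g ->
  computable vars (fun x => f x + g x).
Proof.
move=> hf hg; apply: (computable_iteri hg hf (computable_succ (computable_last _))).
by move=> x; elim: (g x) => [|n IH] /=; [rewrite addn0|rewrite IH addnS].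
Qed.

Lemma computable_pred f : computable vars f ->
  computable vars (fun x => (f x).-1).
Proof.
move=> hf; apply: (computable_iteri hf (computable_zero _)
  (computable_weak (computable_last _))).
by move=> x; case: (f x).
Qed.

End Addition.

Section Comparisons.
Variables (T : Type) (vars : seq (T -> nat)).
Implicit Types f g : T -> nat.

Lemma computable_weak2 f : computable vars f ->
  computable (extend (extend vars)) (fun u => f u.1.1).
Proof. by move=> hf; exact: computable_weak (computable_weak hf). Qed.

Lemma computable_mul f g : computable vars f -> computable vars g ->
  computable vars (fun x => f x * g x).
Proof.
move=> hf hg; apply: (computable_iteri hg (computable_zero _)
  (computable_add (computable_last _) (computable_weak2 hf))).
by move=> x; elim: (g x) => [|n IH] /=; [rewrite muln0|rewrite IH mulnS addnC].
Qed.

Lemma computable_sub f g : computable vars f -> computable vars g ->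
  computable vars (fun x => f x - g x).
Proof.
move=> hf hg; apply: (computable_iteri hg hf (computable_pred (computable_last _))).
by move=> x; elim: (g x) => [|n IH] /=; [rewrite subn0|rewrite IH subnS].
Qed.

Lemma decides_eq0 f : computable vars f -> decides vars (fun x => f x == 0).
Proof.
move=> hf; apply: computable_ext (computable_sub (computable_const _ 1) hf) => x.
by case: (f x) => [|[]].
Qed.

Lemma decides_le f g : computable vars f -> computable vars g ->
  decides vars (fun x => f x <= g x).
Proof. by move=> hf hg; exact: (decides_eq0 (computable_sub hf hg)). Qed.

Lemma decides_lt f g : computable vars f -> computable vars g ->
  decides vars (fun x => f x < g x).
Proof. by move=> hf hg; exact: decides_le (computable_succ hf) hg. Qed.

Lemma decides_and p q : decides vars p -> decides vars q ->
  decides vars (fun x => p x && q x).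
Proof.
move=> hp hq; apply: computable_ext (computable_mul hp hq) => x.
by rewrite mulnb.
Qed.

Lemma decides_not p : decides vars p -> decides vars (fun x => ~~ p x).
Proof. by move=> /decides_eq0; apply: computable_ext => x; case: (p x). Qed.

Lemma decides_ext p q : p =1 q -> decides vars p -> decides vars q.
Proof. by move=> E; apply: computable_ext => x; rewrite E. Qed.

Lemma decides_or p q : decides vars p -> decides vars q ->
  decides vars (fun x => p x || q x).
Proof.
move=> hp hq; apply: decides_ext (decides_not (decides_and (decides_not hp)
  (decides_not hq))) => x.
by rewrite negb_and !negbK.
Qed.

Lemma decides_imply p q : decides vars p -> decides vars q ->
  decides vars (fun x => p x ==> q x).
Proof.
move=> hp hq; apply: decides_ext (decides_or (decides_not hp) hq) => x.
by rewrite implybE.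
Qed.

Lemma decides_eq f g : computable vars f -> computable vars g ->
  decides vars (fun x => f x == g x).
Proof.
move=> hf hg; apply: decides_ext (decides_and (decides_le hf hg) (decides_le hg hf)).
by move=> x; rewrite eqn_leq.
Qed.

End Comparisons.

Section Sums.
Variables (T : Type) (vars : seq (T -> nat)).
Implicit Types f g : T -> nat.

Lemma computable_exp f g : computable vars f -> computable vars g ->
  computable vars (fun x => f x ^ g x).
Proof.
move=> hf hg; apply: (computable_iteri hg (computable_const _ 1)
  (computable_mul (computable_last _) (computable_weak2 hf))).
by move=> x; elim: (g x) => [|n IH] //=; rewrite IH expnSr.
Qed.

Lemma computable_sum n (f : T * nat -> nat) : computable vars n ->
  computable (extend vars) f ->
  computable vars (fun x => \sum_(i < n x) f (x, val i)).
Proof.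
move=> hn hf; apply: (computable_iteri hn (computable_zero _)
  (computable_add (computable_last _) (computable_weak hf))).
by move=> x /=; elim: (n x) => [|m IH] /=; rewrite ?big_ord0 ?big_ord_recr //= IH.
Qed.

End Sums.

Section Quantifiers.
Variables (T : Type) (vars : seq (T -> nat)).
Implicit Types (f g n : T -> nat) (p : pred (T * nat)).

(** A bounded quantifier is decided by the sum of the truth values. *)
Lemma decides_exists n p : computable vars n -> decides (extend vars) p ->
  decides vars (fun x => [exists i : 'I_(n x), p (x, val i)]).
Proof.
move=> hn hp; have := computable_sum hn hp.
move=> /decides_eq0/decides_not; apply: decides_ext => x.
rewrite sum_nat_eq0 negb_forall; apply: eq_existsb => i.
by case: (p _).
Qed.

Lemma decides_forall n p : computable vars n -> decides (extend vars) p ->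
  decides vars (fun x => [forall i : 'I_(n x), p (x, val i)]).
Proof.
move=> hn hp; have := decides_not (decides_exists hn (decides_not hp)).
apply: decides_ext => x; rewrite negb_exists; apply: eq_forallb => i.
by rewrite negbK.
Qed.

(** The quotient is the number of positive multiples of the divisor that do not
exceed the dividend. *)
Lemma computable_div f g : computable vars f -> computable vars g ->
  computable vars (fun x => f x %/ (g x).+1).
Proof.
move=> hf hg; have h : decides (extend vars)
    (fun u => u.2.+1 * (g u.1).+1 <= f u.1).
  by apply: decides_le; [apply: computable_mul; apply: computable_succ;
    [exact: computable_last|exact: computable_weak]|exact: computable_weak].
apply: computable_ext (computable_sum hf h) => x /=.
under eq_bigr do rewrite -leq_divRL //.
rewrite -big_mkcond -(big_ord_widen _ (fun=> 1)) ?sum1_card ?card_ord //.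
exact: leq_div.
Qed.

Lemma computable_mod f g : computable vars f -> computable vars g ->
  computable vars (fun x => f x %% (g x).+1).
Proof.
move=> hf hg; have := computable_sub hf (computable_mul (computable_div hf hg)
  (computable_succ hg)).
by apply: computable_ext => x; rewrite {1}(divn_eq (f x) (g x).+1) addKn.
Qed.

End Quantifiers.

(** * Computable rational and Gaussian rational values *)
Section RationalValued.
Local Open Scope ring_scope.
Variables (R : realType) (T : Type) (vars : seq (T -> nat)).
Implicit Types f g : T -> R.

(** The numerator is a difference of natural numbers, so that ring operations and
comparisons reduce to polynomial ones on natural numbers, without signs. *)
Definition rational_valued f : Prop := exists a b e : T -> nat,
  [/\ computable vars a, computable vars b, computable vars e &
   forall x, (0 < e x)%N /\ f x = ((a x)%:R - (b x)%:R) / (e x)%:R].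

Lemma rational_ext f g : f =1 g -> rational_valued f -> rational_valued g.
Proof. by move=> /funext ->. Qed.

Lemma rational_nat n : computable vars n -> rational_valued (fun x => (n x)%:R).
Proof.
move=> hn; exists n, (fun=> 0%N), (fun=> 1%N); split=> //.
- exact: computable_zero.
- exact: computable_const.
by move=> x; rewrite subr0 divr1.
Qed.

Lemma rational_opp f : rational_valued f -> rational_valued (fun x => - f x).
Proof.
move=> [a [b [e [ha hb he h]]]]; exists b, a, e; split=> // x.
by have [-> ->] := h x; rewrite -mulNr opprB.
Qed.

Lemma rational_add f g : rational_valued f -> rational_valued g ->
  rational_valued (fun x => f x + g x).
Proof.
move=> [a [b [e [ha hb he h]]]] [a' [b' [e' [ha' hb' he' h']]]].
exists (fun x => a x * e' x + a' x * e x)%N, (fun x => b x * e' x + b' x * e x)%N,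
  (fun x => e x * e' x)%N.
split; do 1?[by do ?[apply: computable_add|apply: computable_mul]].
move=> x; have [e0 ->] := h x; have [e0' ->] := h' x.
rewrite muln_gt0 e0 e0'; split=> //; rewrite !natrD !natrM.
by field; rewrite !pnatr_eq0 -!lt0n e0 e0'.
Qed.

Lemma rational_mul f g : rational_valued f -> rational_valued g ->
  rational_valued (fun x => f x * g x).
Proof.
move=> [a [b [e [ha hb he h]]]] [a' [b' [e' [ha' hb' he' h']]]].
exists (fun x => a x * a' x + b x * b' x)%N, (fun x => a x * b' x + b x * a' x)%N,
  (fun x => e x * e' x)%N.
split; do 1?[by do ?[apply: computable_add|apply: computable_mul]].
move=> x; have [e0 ->] := h x; have [e0' ->] := h' x.
rewrite muln_gt0 e0 e0'; split=> //; rewrite !natrD !natrM.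
by field; rewrite !pnatr_eq0 -!lt0n e0 e0'.
Qed.

Lemma rational_sub f g : rational_valued f -> rational_valued g ->
  rational_valued (fun x => f x - g x).
Proof. by move=> hf hg; exact: rational_add hf (rational_opp hg). Qed.

Lemma rational_div f n : rational_valued f -> computable vars n ->
  rational_valued (fun x => f x / (n x).+1%:R).
Proof.
move=> [a [b [e [ha hb he h]]]] hn; exists a, b, (fun x => e x * (n x).+1)%N.
split=> //; first by apply: computable_mul => //; exact: computable_succ.
move=> x; have [e0 ->] := h x; rewrite muln_gt0 e0; split=> //.
by rewrite natrM invfM mulrA.
Qed.

Lemma decides_ler f g : rational_valued f -> rational_valued g ->
  decides vars (fun x => f x <= g x).
Proof.
move=> hf hg; have [a [b [e [ha hb he h]]]] := rational_sub hg hf.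
apply: decides_ext (decides_le hb ha) => x; have [e0 E] := h x.
by rewrite -[RHS]subr_ge0 E pmulr_lge0 ?invr_gt0 ?ltr0n // subr_ge0 ler_nat.
Qed.

Lemma decides_ltr f g : rational_valued f -> rational_valued g ->
  decides vars (fun x => f x < g x).
Proof.
move=> hf hg; apply: decides_ext (decides_not (decides_ler hg hf)) => x.
by rewrite ltNge.
Qed.

End RationalValued.

Lemma rational_weak (R : realType) T (vars : seq (T -> nat)) (f : T -> R) :
  rational_valued vars f -> rational_valued (extend vars) (fun u => f u.1).
Proof.
move=> [a [b [e [ha hb he h]]]].
exists (fun u => a u.1), (fun u => b u.1), (fun u => e u.1).
by split=> [|||u]; do ?exact: computable_weak.
Qed.

Section GaussianValued.
Local Open Scope ring_scope.
Variables (R : realType) (T : Type) (vars : seq (T -> nat)).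
Implicit Types f g : T -> C R.

Definition gaussian_valued f :=
  rational_valued vars (fun x => complex.Re (f x)) /\
  rational_valued vars (fun x => complex.Im (f x)).

Lemma gaussian_ext f g : f =1 g -> gaussian_valued f -> gaussian_valued g.
Proof. by move=> /funext ->. Qed.

Lemma gaussian_add f g : gaussian_valued f -> gaussian_valued g ->
  gaussian_valued (fun x => f x + g x).
Proof.
move=> [h1 h2] [h3 h4]; split.
  apply: rational_ext (rational_add h1 h3) => x.
  by case: (f x) (g x) => [? ?] [? ?].
apply: rational_ext (rational_add h2 h4) => x.
by case: (f x) (g x) => [? ?] [? ?].
Qed.

Lemma gaussian_mul f g : gaussian_valued f -> gaussian_valued g ->
  gaussian_valued (fun x => f x * g x).
Proof.
move=> [h1 h2] [h3 h4]; split.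
  apply: rational_ext (rational_sub (rational_mul h1 h3) (rational_mul h2 h4)) => x.
  by case: (f x) (g x) => [? ?] [? ?].
apply: rational_ext (rational_add (rational_mul h1 h4) (rational_mul h2 h3)) => x.
by case: (f x) (g x) => [? ?] [? ?].
Qed.

Lemma gaussian_nat n : gaussian_valued (fun _ => n%:R).
Proof.
elim: n => [|n IH].
  by split; exact: (rational_nat _ (computable_zero _)).
apply: (@gaussian_ext (fun _ => n%:R + 1)); first by move=> x; rewrite -natr1.
apply: gaussian_add => //.
by split; [exact: (rational_nat _ (computable_const _ 1))|
  exact: (rational_nat _ (computable_zero _))].
Qed.

Lemma gaussian_exp f n : gaussian_valued f -> gaussian_valued (fun x => f x ^+ n).
Proof.
move=> hf; elim: n => [|n IH]; first exact: (gaussian_nat 1).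
by apply: gaussian_ext (gaussian_mul hf IH) => x; rewrite exprS.
Qed.

Lemma gaussian_sum n (F : 'I_n -> T -> C R) : (forall i, gaussian_valued (F i)) ->
  gaussian_valued (fun x => \sum_(i < n) F i x).
Proof.
elim: n F => [|n IH] F hF.
  by apply: gaussian_ext (gaussian_nat 0) => x; rewrite big_ord0.
apply: gaussian_ext (gaussian_add (hF ord0) (IH (fun i => F (lift ord0 i)) _)) => //.
by move=> x; rewrite big_ord_recl.
Qed.

End GaussianValued.

Local Open Scope ring_scope.

(** * The modulus of a complex number as a real number *)
Section Modulus.
Variable R : realType.
Implicit Types z w : C R.

Definition modulus (z : C R) : R := complex.Re `|z|.

Lemma normE z : `|z| = (modulus z)%:C%C.
Proof. by case: z => a b. Qed.

Lemma modulusE z : modulus z ^+ 2 = complex.Re z ^+ 2 + complex.Im z ^+ 2.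
Proof. by case: z => a b; rewrite /modulus /= sqr_sqrtr // addr_ge0 ?sqr_ge0. Qed.

Lemma modulus_ge0 z : 0 <= modulus z.
Proof. by case: z => a b; rewrite /modulus /= sqrtr_ge0. Qed.

Lemma modulusM z w : modulus (z * w) = modulus z * modulus w.
Proof. exact: ComplexField.Normc.normcM. Qed.

Lemma modulusD z w : modulus (z + w) <= modulus z + modulus w.
Proof.
by have := ler_normD z w; rewrite !normE -rmorphD lecR.
Qed.

Lemma modulusN z : modulus (- z) = modulus z.
Proof. by rewrite /modulus normrN. Qed.

Lemma modulusBC z w : modulus (z - w) = modulus (w - z).
Proof. by rewrite -modulusN opprB. Qed.

Lemma modulus_sub_ge z w : modulus z - modulus w <= modulus (z - w).
Proof. by rewrite lerBlDr -{1}(subrK w z) modulusD. Qed.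

Lemma modulus_trans z w u : modulus (z - w) <= modulus (z - u) + modulus (u - w).
Proof. by rewrite -{1}(subrK u z) -addrA modulusD. Qed.

Lemma modulus0 : modulus 0 = 0. Proof. by rewrite /modulus normr0. Qed.
Lemma modulus1 : modulus 1 = 1. Proof. by rewrite /modulus normr1. Qed.

Lemma modulusX z n : modulus (z ^+ n) = modulus z ^+ n.
Proof.
by elim: n => [|n IH]; rewrite ?expr0 ?modulus1 // !exprS modulusM IH.
Qed.

Lemma modulus_nat n : modulus n%:R = n%:R.
Proof.
elim: n => [|n IH]; first exact: modulus0.
by rewrite /modulus normr_nat -[n.+1%:R](rmorph_nat (real_complex R)).
Qed.

Lemma modulus_sum n (F : 'I_n -> C R) :
  modulus (\sum_(i < n) F i) <= \sum_(i < n) modulus (F i).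
Proof.
elim/big_ind2: _ => [|x1 x2 y1 y2 h1 h2|//]; first by rewrite modulus0.
by apply: le_trans (modulusD _ _) _; exact: lerD.
Qed.

Lemma modulus_prod (I : Type) (r : seq I) (F : I -> C R) :
  modulus (\prod_(i <- r) F i) = \prod_(i <- r) modulus (F i).
Proof.
elim/big_ind2: _ => [|x1 x2 y1 y2 h1 h2|//]; first exact: modulus1.
by rewrite modulusM h1 h2.
Qed.

Lemma Re_le_modulus z : `|complex.Re z| <= modulus z.
Proof.
rewrite -(@ler_pXn2r _ 2) ?nnegrE ?modulus_ge0 // modulusE real_normK ?num_real //.
by rewrite lerDl sqr_ge0.
Qed.

Lemma Im_le_modulus z : `|complex.Im z| <= modulus z.
Proof.
rewrite -(@ler_pXn2r _ 2) ?nnegrE ?modulus_ge0 // modulusE real_normK ?num_real //.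
by rewrite lerDr sqr_ge0.
Qed.

Lemma modulus_le_ReIm z : modulus z <= `|complex.Re z| + `|complex.Im z|.
Proof.
rewrite -(@ler_pXn2r _ 2) ?nnegrE ?addr_ge0 ?modulus_ge0 // modulusE sqrrD.
rewrite !real_normK ?num_real // addrAC lerDl.
by rewrite mulrn_wge0 // mulr_ge0.
Qed.

Lemma ReB z w : complex.Re (z - w) = complex.Re z - complex.Re w.
Proof. by case: z w => [? ?] [? ?]. Qed.

Lemma ImB z w : complex.Im (z - w) = complex.Im z - complex.Im w.
Proof. by case: z w => [? ?] [? ?]. Qed.

Lemma modulus_sqrB z w :
  `|modulus z ^+ 2 - modulus w ^+ 2| <= modulus (z - w) * (modulus z + modulus w).
Proof.
rewrite subr_sqr normrM [X in _ * X]ger0_norm ?addr_ge0 ?modulus_ge0 //.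
apply: ler_wpM2r; first by rewrite addr_ge0 ?modulus_ge0.
rewrite ler_norml modulus_sub_ge lerNl opprB modulusBC modulus_sub_ge //.
Qed.

End Modulus.

(** * Estimates for polynomials on discs *)
Section PolynomialEstimates.
Variable R : realType.
Implicit Types (P Q : {poly C R}) (z q : C R).

Lemma modulus_subX D z q i : modulus z <= D -> modulus q <= D ->
  modulus (z ^+ i - q ^+ i) <= i%:R * D ^+ i.-1 * modulus (z - q).
Proof.
move=> hz hq; have D0 : 0 <= D by exact: le_trans (modulus_ge0 z) hz.
rewrite subrXX modulusM mulrC; apply: ler_wpM2r; first exact: modulus_ge0.
apply: le_trans (modulus_sum _) _.
apply: le_trans (_ : \sum_(j < i) D ^+ i.-1 <= _); last first.
  by rewrite sumr_const card_ord mulr_natl.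
apply: ler_sum => j _; rewrite modulusM !modulusX.
rewrite -[X in _ <= D ^+ X](@subnK j); last by have := ltn_ord j; lia.
rewrite exprD; apply: ler_pM; rewrite ?exprn_ge0 ?modulus_ge0 //.
  by apply: lerXn2r; rewrite ?nnegrE ?modulus_ge0.
by apply: lerXn2r; rewrite ?nnegrE ?modulus_ge0.
Qed.

Lemma horner_bound n (M D : R) P z : (size P <= n)%N -> 1 <= D ->
  (forall i, modulus P`_i <= M) -> modulus z <= D ->
  modulus P.[z] <= n%:R * M * D ^+ n.
Proof.
move=> sP D1 hP hz; rewrite (horner_coef_wide _ sP).
apply: le_trans (modulus_sum _) _.
apply: le_trans (_ : \sum_(j < n) M * D ^+ n <= _); last first.
  by rewrite sumr_const card_ord -[X in X <= _]mulr_natl mulrA.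
apply: ler_sum => j _; rewrite modulusM modulusX.
apply: ler_pM; rewrite ?exprn_ge0 ?modulus_ge0 //.
apply: le_trans (_ : D ^+ j <= _).
  by apply: lerXn2r; rewrite ?nnegrE ?modulus_ge0 //; lra.
by apply: ler_weXn2l => //; exact: ltnW.
Qed.

(** The effect of moving both the point and the coefficients by at most [e],
relative to the bound [M] on the latter. The explicit constant is one that the
machine can compute. *)
Lemma horner_perturbation n (M D e : R) P Q z q :
  (size P <= n)%N -> (size Q <= n)%N -> 1 <= D ->
  (forall i, modulus Q`_i <= M) -> (forall i, modulus (P`_i - Q`_i) <= M * e) ->
  modulus z <= D -> modulus q <= D -> modulus (z - q) <= e ->
  modulus (P.[z] - Q.[q]) <= n%:R ^+ 2 * M * D ^+ n * e.
Proof.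
move=> sP sQ D1 hQ hPQ hz hq hzq.
have M0 : 0 <= M by exact: le_trans (modulus_ge0 _) (hQ 0%N).
have e0 : 0 <= e by exact: le_trans (modulus_ge0 _) hzq.
have D0 : 0 <= D by lra.
rewrite (horner_coef_wide _ sP) (horner_coef_wide _ sQ) -sumrB.
apply: le_trans (modulus_sum _) _.
apply: le_trans (_ : \sum_(j < n) n%:R * M * D ^+ n * e <= _); last first.
  by rewrite sumr_const card_ord -[X in X <= _]mulr_natl !mulrA expr2.
apply: ler_sum => j _.
have -> : P`_j * z ^+ j - Q`_j * q ^+ j =
   (P`_j - Q`_j) * z ^+ j + Q`_j * (z ^+ j - q ^+ j) by ring.
apply: le_trans (modulusD _ _) _; rewrite !modulusM modulusX.
have DX i : (i <= n)%N -> D ^+ i <= D ^+ n by move=> h; apply: ler_weXn2l.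
have jn : (j < n)%N by [].
apply: le_trans (_ : M * e * D ^+ n + M * (j%:R * D ^+ n * e) <= _).
  apply: lerD.
    apply: ler_pM; rewrite ?exprn_ge0 ?modulus_ge0 //.
    apply: le_trans (DX j (ltnW jn)).
    by apply: lerXn2r; rewrite ?nnegrE ?modulus_ge0.
  apply: ler_pM; rewrite ?modulus_ge0 //.
  apply: le_trans (modulus_subX _ hz hq) _.
  apply: ler_pM; rewrite ?mulr_ge0 ?exprn_ge0 ?modulus_ge0 //.
  by apply: ler_wpM2l => //; apply: DX; lia.
have -> : M * e * D ^+ n + M * (j%:R * D ^+ n * e) = j.+1%:R * (M * D ^+ n * e).
  by rewrite -natr1; ring.
rewrite -!mulrA; apply: ler_wpM2r; first by rewrite !mulr_ge0 ?exprn_ge0.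
by rewrite ler_nat.
Qed.

Lemma horner_lipschitz P (D : R) : exists2 L, 0 <= L &
  forall z q, modulus z <= D -> modulus q <= D ->
    modulus (P.[z] - P.[q]) <= L * modulus (z - q).
Proof.
pose M := \sum_(i < size P) modulus P`_i.
have hM i : modulus P`_i <= M.
  have [h|h] := ltnP i (size P); last first.
    by rewrite nth_default // modulus0 sumr_ge0 // => j _; exact: modulus_ge0.
  rewrite /M (bigD1 (Ordinal h)) //= lerDl sumr_ge0 // => j _; exact: modulus_ge0.
have M0 : 0 <= M by exact: le_trans (modulus_ge0 _) (hM 0%N).
pose D1 := Num.max D 1.
have D11 : 1 <= D1 by rewrite le_max lexx orbT.
have DD1 : D <= D1 by rewrite le_max lexx.
exists ((size P)%:R ^+ 2 * M * D1 ^+ size P).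
  by rewrite !mulr_ge0 ?exprn_ge0 //; lra.
move=> z q hz hq; apply: horner_perturbation => //.
- by move=> i; rewrite subrr modulus0 mulr_ge0 ?modulus_ge0.
- exact: le_trans hz DD1.
- exact: le_trans hq DD1.
Qed.

Lemma horner_bounded P (D : R) : exists2 L, 0 <= L &
  forall z, modulus z <= D -> modulus P.[z] <= L.
Proof.
have [L L0 hL] := horner_lipschitz P (Num.max D 0).
exists (modulus P.[0] + L * Num.max D 0).
  by rewrite addr_ge0 ?modulus_ge0 ?mulr_ge0 // le_max lexx orbT.
move=> z hz; rewrite -{1}(subrK P.[0] P.[z]) [leRHS]addrC.
apply: le_trans (modulusD _ _) _; apply: lerD => //.
apply: le_trans (hL _ _ _ _) _; rewrite ?modulus0 ?subr0 ?le_max ?hz ?lexx ?orbT //.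
by apply: ler_wpM2l => //; rewrite le_max hz.
Qed.

Lemma horner_taylor P (D : R) : exists2 L, 0 <= L &
  forall z q, modulus z <= D -> modulus q <= D ->
    modulus (P.[z] - P.[q] - (z - q) * P^`().[q]) <= L * modulus (z - q) ^+ 2.
Proof.
elim/poly_ind: P => [|P c [H H0 hH]].
  by exists 0 => // z q _ _; rewrite deriv0 !horner0 subrr mulr0 subrr modulus0 mul0r.
have [L L0 hL] := horner_lipschitz P D.
exists (Num.max D 0 * H + L).
  by rewrite addr_ge0 // mulr_ge0 // le_max lexx orbT.
move=> z q hz hq; rewrite derivMXaddC !hornerMXaddC hornerD hornerMX.
have -> : P.[z] * z + c - (P.[q] * q + c) - (z - q) * (P.[q] + P^`().[q] * q) =
  q * (P.[z] - P.[q] - (z - q) * P^`().[q]) + (z - q) * (P.[z] - P.[q]) by ring.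
apply: le_trans (modulusD _ _) _; rewrite !modulusM.
set m := modulus (z - q).
apply: le_trans (_ : Num.max D 0 * (H * m ^+ 2) + m * (L * m) <= _); last first.
  by rewrite le_eqVlt; apply/orP; left; apply/eqP; ring.
apply: lerD.
  by apply: ler_pM; rewrite ?modulus_ge0 ?le_max ?hq //; exact: hH.
by apply: ler_wpM2l; [exact: modulus_ge0|exact: hL].
Qed.

End PolynomialEstimates.

(** * Certificates of hyperbolicity *)
Section Certificate.
Variables (R : realType) (l : nat).

(** Here [v] is the answer of the oracle: real parts, then imaginary parts. *)
Definition approximant (v : 'rV[rat]_(l + l)) : 'rV[C R]_l :=
  \row_i (ratr (v 0 (lshift l i)) +i* ratr (v 0 (rshift l i)))%C.

Definition approx_poly (v : 'rV[rat]_(l + l)) : {poly C R} :=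
  @monic_centered R l.+1 (approximant v).

(** If the entries of [approximant v] have parts of absolute value at most [A],
the coefficients of p have modulus at most 2A + 2, hence all bounded orbits stay
in the disc of radius [box A] - 1. *)
Definition box (A : nat) : nat := (l * (2 * A + 2) + 3)%N.

Definition side (A N : nat) : nat := (2 * box A * N.+1).+1.

Definition node (A N i : nat) : R := i%:R / N.+1%:R - (box A)%:R.

Definition cell (A N i j : nat) : C R := (node A N i +i* node A N j)%C.

(** The table is the expansion of [x] in base [b.+1], one digit for each node. *)
Definition label (x A N b i j : nat) : nat :=
  (x %/ b.+1 ^ (i * side A N + j) %% b.+1)%N.

Definition kind (x A N b i j : nat) : nat := (label x A N b i j %% 3)%N.
Definition value (x A N b i j : nat) : nat := (label x A N b i j %/ 3)%N.

(** The constant of [horner_perturbation] for p and for p' on a disc around all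
cells. *)
Definition spread (A : nat) : nat :=
  (l.+1 * l.+2 ^ 2 * (2 * A + 2) * (2 * box A + 2) ^ l.+2)%N.

(** In units of the mesh, a bound for the error on p and on |p'|^2 that is due to
rounding a point of a cell to its node and the coefficients to the answer of the
oracle. *)
Definition slack (A : nat) : nat := (4 * spread A ^ 2)%N.

Definition in_box (A N : nat) (a : R) : bool :=
  (- (box A)%:R + (slack A)%:R / N.+1%:R <= a) &&
  (a <= (box A)%:R - (slack A)%:R / N.+1%:R).

(** One unit of the mesh on top of [slack], as p(z) and the node of its cell may
differ by so much. *)
Definition nearby (A N : nat) (a b : R) : bool :=
  (a - b < (slack A).+1%:R / N.+1%:R) && (b - a < (slack A).+1%:R / N.+1%:R).

Definition bounded_entries (A : nat) (v : 'rV[rat]_(l + l)) : bool :=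
  [forall j, (- A%:R <= ratr (v 0 j) :> R) && (ratr (v 0 j) <= A%:R :> R)].

Definition trap_ok (t : input (l + l)) (A N b i j : nat) : bool :=
  let y := (approx_poly t.2).[cell A N i j] in
  (kind t.1 A N b i j == 0) ==>
  in_box A N (complex.Re y) && in_box A N (complex.Im y).

Definition arrow (t : input (l + l)) (A N i j i' j' : nat) : bool :=
  let y := (approx_poly t.2).[cell A N i j] in
  nearby A N (complex.Re y) (node A N i') && nearby A N (complex.Im y) (node A N j').

(** A lower bound for |p'|^2 on the cell. *)
Definition expansion (t : input (l + l)) (A N i j : nat) : R :=
  let y := (approx_poly t.2)^`().[cell A N i j] in
  complex.Re y ^+ 2 + complex.Im y ^+ 2 - (slack A)%:R / N.+1%:R.

Definition arrow_ok (t : input (l + l)) (A N b i j i' j' : nat) : bool :=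
  let k := kind t.1 A N b i j in let k' := kind t.1 A N b i' j' in
  let r := value t.1 A N b i j in let r' := value t.1 A N b i' j' in
  [&& (k == 0) ==> (k' == 0),
      (k == 1) ==> ((k' == 1) && (r < r')%N) &
      ((k == 2) && (k' == 2)) ==>
        (r.+2%:R <= expansion t A N i j * r'.+1%:R)].

Definition valid (t : input (l + l)) (A N b : nat) : bool :=
  bounded_entries A t.2 &&
  [forall i : 'I_(side A N), [forall j : 'I_(side A N),
    trap_ok t A N b i j &&
    [forall i' : 'I_(side A N), [forall j' : 'I_(side A N),
      arrow t A N i j i' j' ==> arrow_ok t A N b i j i' j']]]].

(** Bounding the parameters by the number [x] that codes the table loses nothing,
as the digits beyond the table are free; and the precision 2^-x of the query is
then not coarser than the mesh. *)
Definition accepts (t : input (l + l)) : bool :=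
  [exists A : 'I_t.1.+1, [exists N : 'I_t.1.+1, [exists b : 'I_t.1.+1,
    valid t A N b]]].

End Certificate.

Lemma monic_centered_horner (R : realType) l (c : 'rV[C R]_l) z :
  (@monic_centered R l.+1 c).[z] = z ^+ l.+1 + \sum_(i < l) c 0 i * z ^+ i.
Proof.
rewrite /monic_centered hornerD hornerXn horner_sum; congr (_ + _).
by apply: eq_bigr => i _; rewrite hornerZ hornerXn.
Qed.

Lemma monic_centered_deriv (R : realType) l (c : 'rV[C R]_l) z :
  (@monic_centered R l.+1 c)^`().[z] =
  l.+1%:R * z ^+ l + \sum_(i < l) c 0 i * (i%:R * z ^+ i.-1).
Proof.
rewrite /monic_centered derivD derivXn hornerD hornerMn hornerXn mulr_natl.
rewrite (linear_sum (@deriv (C R))) horner_sum; congr (_ + _).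
apply: eq_bigr => i _.
by rewrite /= derivZ derivXn hornerZ hornerMn hornerXn mulr_natl.
Qed.

(** * Certificates are decidable *)
Section Decidable.
Variables (R : realType) (l : nat) (T : Type) (vars : seq (T -> nat)).
Variables (t : T -> input (l + l)) (A N b : T -> nat).
Hypothesis ht1 : computable vars (fun y => (t y).1).
Hypothesis ht2 : forall j, rational_valued vars (fun y => ratr ((t y).2 0 j) : R).
Hypothesis hA : computable vars A.
Hypothesis hN : computable vars N.
Hypothesis hb : computable vars b.

Ltac comp_tac := repeat first [ assumption | exact: computable_const |
  lazymatch goal with
  | |- computable _ (fun y => expn (@?f y) (@?g y)) =>
      apply: (@computable_exp _ _ f g)
  | |- computable _ (fun y => muln (@?f y) (@?g y)) =>
      apply: (@computable_mul _ _ f g)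
  | |- computable _ (fun y => addn (@?f y) (@?g y)) =>
      apply: (@computable_add _ _ f g)
  | |- computable _ (fun y => S (@?f y)) => apply: (@computable_succ _ _ f)
  end].

Lemma computable_box : computable vars (fun y => box l (A y)).
Proof. by rewrite /box; comp_tac. Qed.

Lemma computable_side : computable vars (fun y => side l (A y) (N y)).
Proof.
by apply: computable_succ; do ?apply: computable_mul; comp_tac; exact: computable_box.
Qed.

Lemma computable_slack : computable vars (fun y => slack l (A y)).
Proof.
have := computable_box => h.
by rewrite /slack /spread; comp_tac.
Qed.

Lemma rational_node i : computable vars i ->
  rational_valued vars (fun y => node R l (A y) (N y) (i y)).
Proof.
move=> hi; apply: rational_sub; last exact/rational_nat/computable_box.
by apply: rational_div => //; exact: rational_nat.
Qed.

Lemma rational_margin : rational_valued vars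
  (fun y => (slack l (A y))%:R / (N y).+1%:R : R).
Proof. by apply: rational_div => //; exact/rational_nat/computable_slack. Qed.

Lemma gaussian_cell i j : computable vars i -> computable vars j ->
  gaussian_valued vars (fun y => cell R l (A y) (N y) (i y) (j y)).
Proof. by move=> hi hj; split; exact: rational_node. Qed.

Lemma gaussian_coef i : gaussian_valued vars (fun y => approximant R (t y).2 0 i).
Proof.
by split; [apply: rational_ext (ht2 (lshift l i))|
  apply: rational_ext (ht2 (rshift l i))] => y; rewrite mxE.
Qed.

Lemma gaussian_value (z : T -> C R) : gaussian_valued vars z ->
  gaussian_valued vars (fun y => (approx_poly R (t y).2).[z y]).
Proof.
move=> hz; apply: (gaussian_ext (f := fun y => z y ^+ l.+1 +
    \sum_(i < l) approximant R (t y).2 0 i * z y ^+ i)).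
  by move=> y; rewrite -monic_centered_horner.
apply: gaussian_add; first exact: gaussian_exp.
apply: gaussian_sum => i; apply: gaussian_mul; first exact: gaussian_coef.
exact: gaussian_exp.
Qed.

Lemma gaussian_deriv (z : T -> C R) : gaussian_valued vars z ->
  gaussian_valued vars (fun y => (approx_poly R (t y).2)^`().[z y]).
Proof.
move=> hz; apply: (gaussian_ext (f := fun y => l.+1%:R * z y ^+ l +
    \sum_(i < l) approximant R (t y).2 0 i * (i%:R * z y ^+ i.-1))).
  by move=> y; rewrite -monic_centered_deriv.
apply: gaussian_add.
  by apply: gaussian_mul; [exact: gaussian_nat|exact: gaussian_exp].
apply: gaussian_sum => i; apply: gaussian_mul; first exact: gaussian_coef.
by apply: gaussian_mul; [exact: gaussian_nat|exact: gaussian_exp].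
Qed.

Lemma computable_label i j : computable vars i -> computable vars j ->
  computable vars (fun y => label l (t y).1 (A y) (N y) (b y) (i y) (j y)).
Proof.
move=> hi hj; rewrite /label.
have hE : computable vars (fun y => ((b y).+1 ^ (i y * side l (A y) (N y) + j y)).-1)%N.
  apply: computable_pred; have := computable_side => h; comp_tac.
apply: computable_mod => //.
apply: computable_ext (computable_div ht1 hE) => y.
by rewrite prednK // expn_gt0.
Qed.

Lemma computable_kind i j : computable vars i -> computable vars j ->
  computable vars (fun y => kind l (t y).1 (A y) (N y) (b y) (i y) (j y)).
Proof.
move=> hi hj; exact: computable_mod (computable_label hi hj) (computable_const _ 2).
Qed.

Lemma computable_value i j : computable vars i -> computable vars j ->
  computable vars (fun y => value l (t y).1 (A y) (N y) (b y) (i y) (j y)).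
Proof.
move=> hi hj; exact: computable_div (computable_label hi hj) (computable_const _ 2).
Qed.

Lemma decides_in_box (a : T -> R) : rational_valued vars a ->
  decides vars (fun y => in_box l (A y) (N y) (a y)).
Proof.
move=> ha; have hB : rational_valued vars (fun y => (box l (A y))%:R : R).
  exact/rational_nat/computable_box.
apply: decides_and; apply: decides_ler => //.
  by apply: rational_add; [exact: rational_opp|exact: rational_margin].
by apply: rational_sub => //; exact: rational_margin.
Qed.

Lemma decides_nearby (a a' : T -> R) : rational_valued vars a ->
  rational_valued vars a' ->
  decides vars (fun y => nearby l (A y) (N y) (a y) (a' y)).
Proof.
move=> ha ha'; have hS : rational_valued vars
    (fun y => (slack l (A y)).+1%:R / (N y).+1%:R : R).
  apply: rational_div => //; apply: rational_nat; apply: computable_succ.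
  exact: computable_slack.
by apply: decides_and; apply: decides_ltr => //; exact: rational_sub.
Qed.

Lemma decides_bounded_entries :
  decides vars (fun y => bounded_entries R (A y) (t y).2).
Proof.
pose q (j : 'I_(l + l)) y := (- (A y)%:R <= ratr ((t y).2 0 j) :> R) &&
  (ratr ((t y).2 0 j) <= (A y)%:R :> R).
apply: (decides_ext (p := fun y => all (q^~ y) (enum 'I_(l + l)))).
  move=> y; apply/allP/forallP => [h j|h j _]; last exact: h.
  by apply: h; rewrite mem_enum.
elim: (enum _) => [|j s IH] /=; first exact: (computable_const _ 1).
apply: decides_and => //; have hA' : rational_valued vars (fun y => (A y)%:R : R).
  exact: rational_nat.
by apply: decides_and; apply: decides_ler => //; exact: rational_opp.
Qed.

Lemma decides_trap_ok i j : computable vars i -> computable vars j ->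
  decides vars (fun y => trap_ok R (t y) (A y) (N y) (b y) (i y) (j y)).
Proof.
move=> hi hj; have [h1 h2] := gaussian_value (gaussian_cell hi hj).
apply: decides_imply.
  by apply: decides_eq; [exact: computable_kind|exact: computable_zero].
by apply: decides_and; exact: decides_in_box.
Qed.

Lemma decides_arrow i j i' j' : computable vars i -> computable vars j ->
  computable vars i' -> computable vars j' ->
  decides vars (fun y => arrow R (t y) (A y) (N y) (i y) (j y) (i' y) (j' y)).
Proof.
move=> hi hj hi' hj'; have [h1 h2] := gaussian_value (gaussian_cell hi hj).
by apply: decides_and; apply: decides_nearby => //; exact: rational_node.
Qed.

Lemma decides_arrow_ok i j i' j' : computable vars i -> computable vars j ->
  computable vars i' -> computable vars j' ->
  decides vars (fun y => arrow_ok R (t y) (A y) (N y) (b y) (i y) (j y) (i' y) (j' y)).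
Proof.
move=> hi hj hi' hj'; have [h1 h2] := gaussian_deriv (gaussian_cell hi hj).
have k := computable_kind hi hj; have k' := computable_kind hi' hj'.
have r := computable_value hi hj; have r' := computable_value hi' hj'.
have keq f n : computable vars f -> decides vars (fun y => f y == n).
  by move=> hf; apply: decides_eq => //; exact: computable_const.
apply: decides_and; first by apply: decides_imply; exact: keq.
apply: decides_and.
  apply: decides_imply; first exact: keq.
  by apply: decides_and; [exact: keq|exact: decides_lt].
apply: decides_imply; first by apply: decides_and; exact: keq.
apply: decides_ler; first by apply: rational_nat; do 2 apply: computable_succ.
apply: rational_mul; last by apply: rational_nat; apply: computable_succ.
apply: rational_sub; last exact: rational_margin.
by apply: rational_add; apply: rational_mul.
Qed.

End Decidable.

(** A negative entry has its numerator in the subtracted part. *)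
Lemma rational_ratr (R : realType) l (j : 'I_l) :
  rational_valued (input_vars l) (fun t : input l => ratr (t.2 0%R j) : R).
Proof.
pose s := enum 'I_l; have js : (index j s < size s)%N by rewrite index_mem mem_enum.
have var (f : input l -> nat) i : (i < 3)%N ->
    f = nth (fun=> 0%N) [:: (fun x : input l => (numq (x.2 0%R j) < 0)%R : nat);
       (fun x : input l => `|numq (x.2 0%R j)|%N);
       (fun x : input l => `|denq (x.2 0%R j)|%N)] i ->
    computable (input_vars l) f.
  move=> hi E; have [hs Es] : (1 + 3 * index j s + i < size (input_vars l))%N /\
      f = nth (fun=> 0%N) (input_vars l) (1 + 3 * index j s + i).
    split.
      by rewrite size_input_vars; move: js; rewrite size_enum_ord; lia.
    rewrite E /input_vars -/s; elim: s js => //= a s IH.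
    case: eqP => [->|_].
      by rewrite muln0 addn0; case: i hi {E IH} => [|[|[|]]].
    rewrite ltnS => /IH ->.
    by rewrite mulnS.
  by rewrite Es; exact: computable_var.
have h1 := var _ 0%N isT erefl; have h2 := var _ 1%N isT erefl.
have h3 := var _ 2%N isT erefl.
exists (fun t : input l =>
    `|numq (t.2 0%R j)| * (1 - ((numq (t.2 0%R j) < 0)%R : nat)))%N,
  (fun t : input l => `|numq (t.2 0%R j)| * ((numq (t.2 0%R j) < 0)%R : nat))%N,
  (fun t : input l => `|denq (t.2 0%R j)|%N).
split.
- by apply: computable_mul => //; apply: computable_sub => //; exact: computable_const.
- exact: (computable_mul h2 h1).
- exact: h3.
move=> t; split; first by rewrite absz_gt0 denq_neq0.
rewrite /ratr; congr (_ / _); last first.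
  by rewrite [in RHS]pmulrn gez0_abs // ltW ?denq_gt0.
have [n0|n0] := boolP (numq (t.2 0%R j) < 0).
  by rewrite subnn muln0 muln1 sub0r [in RHS]pmulrn ltz0_abs // mulrNz opprK.
by rewrite subn0 muln0 muln1 subr0 [in RHS]pmulrn gez0_abs // leNgt.
Qed.

(** The quantifiers are peeled one by one, each of them adding a component to the
context; [hx0], [hv] and [la] are then lifted to the context of the rule in
which they occur. *)
Theorem accepts_computable (R : realType) (l : nat) :
  decides (input_vars (l + l)) (@accepts R l).
Proof.
have hx : computable (input_vars (l + l)) (fun t => t.1.+1).
  by apply: computable_succ; exact: (@computable_var _ (input_vars (l + l)) 0).
have wk T (vs : seq (T -> nat)) f : computable vs f ->
  computable (extend vs) (fun u => f u.1) by exact: computable_weak.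
have wk2 T vs f (h : @computable T vs f) := wk _ _ _ (wk _ _ _ h).
have wk3 T vs f (h : @computable T vs f) := wk _ _ _ (wk2 _ _ _ h).
have wk4 T vs f (h : @computable T vs f) := wk _ _ _ (wk3 _ _ _ h).
have wk5 T vs f (h : @computable T vs f) := wk _ _ _ (wk4 _ _ _ h).
have wk6 T vs f (h : @computable T vs f) := wk _ _ _ (wk5 _ _ _ h).
have wk7 T vs f (h : @computable T vs f) := wk _ _ _ (wk6 _ _ _ h).
apply: (decides_exists (p := fun u => [exists N : 'I_u.1.1.+1,
  [exists b : 'I_u.1.1.+1, valid R u.1 u.2 N b]])) => //.
apply: (decides_exists (n := fun u => u.1.1.+1) (p := fun u =>
  [exists b : 'I_u.1.1.1.+1, valid R u.1.1 u.1.2 u.2 b])); first exact: (wk _ _ _ hx).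
apply: (decides_exists (n := fun u => u.1.1.1.+1) (p := fun u =>
  valid R u.1.1.1 u.1.1.2 u.1.2 u.2)); first exact: (wk2 _ _ _ hx).
have hx0 : computable (input_vars (l + l)) fst.
  exact: (@computable_var _ (input_vars (l + l)) 0).
have hv := @rational_ratr R (l + l).
have wr T (vs : seq (T -> nat)) (f : T -> R) : rational_valued vs f ->
  rational_valued (extend vs) (fun u => f u.1) by exact: rational_weak.
have wr2 T vs f (h : @rational_valued R T vs f) := wr _ _ _ (wr _ _ _ h).
have wr3 T vs f (h : @rational_valued R T vs f) := wr _ _ _ (wr2 _ _ _ h).
have wr4 T vs f (h : @rational_valued R T vs f) := wr _ _ _ (wr3 _ _ _ h).
have wr5 T vs f (h : @rational_valued R T vs f) := wr _ _ _ (wr4 _ _ _ h).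
have wr6 T vs f (h : @rational_valued R T vs f) := wr _ _ _ (wr5 _ _ _ h).
have wr7 T vs f (h : @rational_valued R T vs f) := wr _ _ _ (wr6 _ _ _ h).
have la T (vs : seq (T -> nat)) : computable (extend vs) snd by exact: computable_last.
apply: decides_and.
  apply: decides_bounded_entries; first by move=> j; exact: (wr3 _ _ _ (hv j)).
  by exact: (wk2 _ _ _ (la _ _)).
apply: (decides_forall (n := fun u => side l u.1.1.2 u.1.2) (p := fun u =>
  [forall j : 'I_(side l u.1.1.1.2 u.1.1.2),
    trap_ok R u.1.1.1.1 u.1.1.1.2 u.1.1.2 u.1.2 u.2 j &&
    [forall i' : 'I_(side l u.1.1.1.2 u.1.1.2),
      [forall j' : 'I_(side l u.1.1.1.2 u.1.1.2),
      arrow R u.1.1.1.1 u.1.1.1.2 u.1.1.2 u.2 j i' j' ==>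
      arrow_ok R u.1.1.1.1 u.1.1.1.2 u.1.1.2 u.1.2 u.2 j i' j']]])).
  by apply: computable_side; [exact: (wk2 _ _ _ (la _ _))|exact: (wk _ _ _ (la _ _))].
apply: (decides_forall (n := fun u => side l u.1.1.1.2 u.1.1.2) (p := fun u =>
    trap_ok R u.1.1.1.1.1 u.1.1.1.1.2 u.1.1.1.2 u.1.1.2 u.1.2 u.2 &&
    [forall i' : 'I_(side l u.1.1.1.1.2 u.1.1.1.2),
      [forall j' : 'I_(side l u.1.1.1.1.2 u.1.1.1.2),
      arrow R u.1.1.1.1.1 u.1.1.1.1.2 u.1.1.1.2 u.1.2 u.2 i' j' ==>
      arrow_ok R u.1.1.1.1.1 u.1.1.1.1.2 u.1.1.1.2 u.1.1.2 u.1.2 u.2 i' j']])).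
  by apply: computable_side; [exact: (wk3 _ _ _ (la _ _))|exact: (wk2 _ _ _ (la _ _))].
apply: decides_and.
  apply: decides_trap_ok.
  - by exact: (wk5 _ _ _ hx0).
  - by move=> j; exact: (wr5 _ _ _ (hv j)).
  - by exact: (wk4 _ _ _ (la _ _)).
  - by exact: (wk3 _ _ _ (la _ _)).
  - by exact: (wk2 _ _ _ (la _ _)).
  - by exact: (wk _ _ _ (la _ _)).
  - exact: (la _ _).
apply: (decides_forall (n := fun u => side l u.1.1.1.1.2 u.1.1.1.2) (p := fun u =>
    [forall j' : 'I_(side l u.1.1.1.1.1.2 u.1.1.1.1.2),
      arrow R u.1.1.1.1.1.1 u.1.1.1.1.1.2 u.1.1.1.1.2 u.1.1.2 u.1.2 u.2 j' ==>
      arrow_ok R u.1.1.1.1.1.1 u.1.1.1.1.1.2 u.1.1.1.1.2 u.1.1.1.2 u.1.1.2 u.1.2 u.2 j'])).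
  by apply: computable_side; [exact: (wk4 _ _ _ (la _ _))|exact: (wk3 _ _ _ (la _ _))].
apply: (decides_forall (n := fun u => side l u.1.1.1.1.1.2 u.1.1.1.1.2) (p := fun u =>
      arrow R u.1.1.1.1.1.1.1 u.1.1.1.1.1.1.2 u.1.1.1.1.1.2 u.1.1.1.2 u.1.1.2 u.1.2 u.2 ==>
      arrow_ok R u.1.1.1.1.1.1.1 u.1.1.1.1.1.1.2 u.1.1.1.1.1.2 u.1.1.1.1.2 u.1.1.1.2 u.1.1.2 u.1.2 u.2)).
  by apply: computable_side; [exact: (wk5 _ _ _ (la _ _))|exact: (wk4 _ _ _ (la _ _))].
apply: decides_imply.
  apply: decides_arrow.
  - by move=> j; exact: (wr7 _ _ _ (hv j)).
  - by exact: (wk6 _ _ _ (la _ _)).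
  - by exact: (wk5 _ _ _ (la _ _)).
  - by exact: (wk3 _ _ _ (la _ _)).
  - by exact: (wk2 _ _ _ (la _ _)).
  - by exact: (wk _ _ _ (la _ _)).
  - exact: (la _ _).
apply: decides_arrow_ok.
- by exact: (wk7 _ _ _ hx0).
- by move=> j; exact: (wr7 _ _ _ (hv j)).
- by exact: (wk6 _ _ _ (la _ _)).
- by exact: (wk5 _ _ _ (la _ _)).
- by exact: (wk4 _ _ _ (la _ _)).
- by exact: (wk3 _ _ _ (la _ _)).
- by exact: (wk2 _ _ _ (la _ _)).
- by exact: (wk _ _ _ (la _ _)).
- exact: (la _ _).
Qed.

Local Open Scope classical_set_scope.
Local Open Scope ring_scope.

(** * Iterates and the Julia set *)
Section Iterates.
Variable R : realType.
Implicit Types (p : {poly C R}) (z : C R).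

Definition iterate p n z : C R := iter n (horner p) z.

Definition multiplier p n z : C R := (iter_poly p n)^`().[z].

Lemma iter_poly_horner p n z : (iter_poly p n).[z] = iterate p n z.
Proof.
elim: n => [|n IH] /=; first by rewrite hornerX.
by rewrite /iter_poly /= horner_comp -/(iter_poly p n) IH.
Qed.

Lemma multiplier0 p z : multiplier p 0 z = 1.
Proof. by rewrite /multiplier /= derivX hornerE. Qed.

Lemma multiplierS p n z :
  multiplier p n.+1 z = p^`().[iterate p n z] * multiplier p n z.
Proof.
rewrite /multiplier /iter_poly /= deriv_comp hornerM horner_comp.
by rewrite -/(iter_poly p n) iter_poly_horner.
Qed.

(** The chain rule read from the first step instead of the last one. *)
Lemma multiplierSr p n z :
  multiplier p n.+1 z = multiplier p n p.[z] * p^`().[z].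
Proof.
elim: n => [|n IH]; first by rewrite multiplierS !multiplier0 mulrC.
rewrite multiplierS IH [in RHS]multiplierS mulrA.
by rewrite {1}/iterate iterSr.
Qed.

Lemma filled_juliaP p z : filled_julia p z <->
  exists M : R, forall n, modulus (iterate p n z) <= M.
Proof.
split=> [[M [Mreal hM]]|[M hM]].
  have [a aM] : exists a : R, M < a%:C%C.
    exists (complex.Re M + 1); move: Mreal; case: M {hM} => a b.
    rewrite complex_real /= => /eqP -> /=.
    by rewrite ltcE /= eqxx ltrDl ltr01.
  exists a => n; rewrite -lecR -normE; apply: hM aM _ _.
  by exists n.
exists (M%:C)%C; split; first by rewrite complex_real /=.
move=> x Mx _ [n _ <-] /=; rewrite normE; apply: le_trans (ltW Mx).
by rewrite lecR; exact: hM.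
Qed.

Lemma filled_julia_horner p z : filled_julia p p.[z] <-> filled_julia p z.
Proof.
rewrite !filled_juliaP; split=> [[M hM]|[M hM]].
  exists (Num.max M (modulus z)) => -[|n].
    by rewrite le_max lexx orbT.
  by rewrite le_max /iterate iterSr hM.
by exists M => n; have := hM n.+1; rewrite /iterate iterSr.
Qed.

Lemma nbhs_modulusP z (A : set (C R)) : nbhs z A <->
  exists2 e : R, 0 < e & forall y, modulus (y - z) < e -> A y.
Proof.
split=> [/nbhs_ballP[e /= e0 hA]|[e e0 hA]].
  exists (complex.Re e).
    by move: e0; case: e {hA} => a b; rewrite ltcE /= => /andP[].
  move=> y hy; apply: hA; rewrite -ball_normE /= distrC normE.
  move: e0 hy; case: e => a b; rewrite ltcE /= => /andP[/eqP -> _] h.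
  by rewrite ltcE /= eqxx.
apply/nbhs_ballP; exists (e%:C)%C; first by rewrite /= ltcE /= eqxx.
move=> y; rewrite -ball_normE /= distrC normE ltcR; exact: hA.
Qed.

(** The Julia set consists of the points near which there are both bounded and
unbounded orbits. In this form its invariance is symmetric in the two kinds of
orbits. *)
Lemma juliaP p z : julia p z <-> forall e : R, 0 < e ->
  (exists2 y, filled_julia p y & modulus (y - z) < e) /\
  (exists2 y, ~ filled_julia p y & modulus (y - z) < e).
Proof.
split=> [[hc hi] e e0|h].
  split.
    have [|y [Ky hy]] := hc [set y | modulus (y - z) < e].
      by apply/nbhs_modulusP; exists e.
    by exists y.
  apply: contrapT => hn; apply: hi; apply/nbhs_modulusP; exists e => // y hy.
  by apply: contrapT => Ky; apply: hn; exists y.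
split.
  move=> B /nbhs_modulusP[e e0 hB]; have [[y Ky hy] _] := h e e0.
  by exists y; split=> //; exact: hB.
move=> /nbhs_modulusP[e e0 hB]; have [_ [y Ky hy]] := h e e0.
exact/Ky/hB.
Qed.

Lemma julia_horner p z : julia p z -> julia p p.[z].
Proof.
move=> /juliaP h; apply/juliaP => e e0.
have [L L0 hL] := horner_lipschitz p (modulus z + 1).
pose e' := Num.min 1 (e / (L + 1)).
have e'0 : 0 < e' by rewrite lt_min ltr01 divr_gt0 //; lra.
have H y : modulus (y - z) < e' -> modulus (p.[y] - p.[z]) < e.
  rewrite lt_min => /andP[y1 ye].
  have hy : modulus y <= modulus z + 1.
    by have := modulus_sub_ge y z; lra.
  have hz : modulus z <= modulus z + 1 by lra.
  apply: le_lt_trans (hL _ _ hy hz) _.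
  move: ye; rewrite ltr_pdivlMr; last by lra.
  have := modulus_ge0 (y - z); nra.
have [[y Ky hy] [y' Ky' hy']] := h e' e'0; split.
  by exists p.[y]; [exact/filled_julia_horner|exact: H].
by exists p.[y']; [move=> /filled_julia_horner|exact: H].
Qed.

Lemma julia_iterate p n z : julia p z -> julia p (iterate p n z).
Proof. by move=> h; elim: n => [//|n]; exact: julia_horner. Qed.

End Iterates.

(** * Coefficients of monic centered polynomials *)
Section MonicCentered.
Variables (R : realType) (l : nat).
Implicit Types c : 'rV[C R]_l.

Lemma monic_centered_coef_low c i (il : (i < l)%N) :
  (@monic_centered R l.+1 c)`_i = c 0 (Ordinal il).
Proof.
rewrite /monic_centered coefD coefXn coef_sum (bigD1 (Ordinal il)) //=.
rewrite coefZ coefXn eqxx mulr1 big1 ?addr0; last first.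
  move=> j ji; rewrite coefZ coefXn; case: eqP => [E|]; last by rewrite mulr0.
  by case/eqP: ji; apply: val_inj.
have -> : (i == l.+1) = false by lia.
by rewrite add0r.
Qed.

Lemma monic_centered_coef_high c i : (l <= i)%N ->
  (@monic_centered R l.+1 c)`_i = (i == l.+1)%:R.
Proof.
move=> li; rewrite /monic_centered coefD coefXn coef_sum big1 ?addr0 // => j _.
rewrite coefZ coefXn; have := ltn_ord j => jl.
have -> : (i == j) = false by apply/eqP => E; move: jl; rewrite -E; lia.
by rewrite mulr0.
Qed.

Lemma size_monic_centered c : (size (@monic_centered R l.+1 c) <= l.+2)%N.
Proof.
apply/leq_sizeP => i hi; rewrite monic_centered_coef_high; last by lia.
have -> : (i == l.+1) = false by lia.
by [].
Qed.

Lemma coef_deriv_monic_centered c i (M : R) : 1 <= M ->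
  (forall i, modulus (@monic_centered R l.+1 c)`_i <= M) ->
  modulus (@monic_centered R l.+1 c)^`()`_i <= l.+1%:R * M.
Proof.
move=> M1 hM; rewrite coef_deriv -[_`_i.+1 *+ _]mulr_natl modulusM modulus_nat.
have [il|il] := leqP i l.
  by apply: ler_pM; rewrite ?modulus_ge0 // ler_nat.
rewrite monic_centered_coef_high; last by lia.
have -> : (i.+1 == l.+1) = false by lia.
by rewrite modulus0 mulr0 mulr_ge0 //; lra.
Qed.

Variables (c c' : 'rV[C R]_l) (M e : R).
Hypotheses (M1 : 1 <= M) (hM : forall i, modulus (c' 0 i) <= M).
Hypothesis he : forall i, modulus (c 0 i - c' 0 i) <= e.
Hypothesis e0 : 0 <= e.

Lemma coef_bound i : modulus (@monic_centered R l.+1 c')`_i <= M.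
Proof.
have [il|il] := ltnP i l; first by rewrite monic_centered_coef_low.
rewrite monic_centered_coef_high //; case: eqP => _.
  by rewrite modulus1.
by rewrite modulus0; exact: le_trans ler01 M1.
Qed.

Lemma coef_close i : modulus ((@monic_centered R l.+1 c)`_i -
  (@monic_centered R l.+1 c')`_i) <= e.
Proof.
have [il|il] := ltnP i l; first by rewrite !monic_centered_coef_low.
by rewrite !monic_centered_coef_high // subrr modulus0.
Qed.

Lemma coef_deriv_close i : modulus ((@monic_centered R l.+1 c)^`()`_i -
  (@monic_centered R l.+1 c')^`()`_i) <= l.+1%:R * e.
Proof.
clear M M1 hM; rewrite !coef_deriv -mulrnBl -[(_ - _) *+ _]mulr_natl modulusM modulus_nat.
have [il|il] := leqP i l.
  apply: ler_pM; rewrite ?modulus_ge0 // ?ler_nat //; exact: coef_close.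
rewrite !monic_centered_coef_high; try by lia.
by rewrite subrr modulus0 mulr0 mulr_ge0.
Qed.

End MonicCentered.

(** * Escape to infinity *)
Section Escape.
Variables (R : realType) (l : nat) (c : 'rV[C R]_l) (M : R).
Hypotheses (l0 : (0 < l)%N) (hM : forall i, modulus (c 0 i) <= M).
Local Notation p := (@monic_centered R l.+1 c).
Local Notation r := (l%:R * M + 2).

(** The lower terms amount to at most l M |z|^l, so that |p(z)| is at least
|z|^l (|z| - l M). This uses l > 0, that is, that the degree is at least 2. *)
Lemma escape_step z : r <= modulus z -> 2 * modulus z <= modulus p.[z].
Proof.
move=> hz.
have M0 : 0 <= M by exact: le_trans (modulus_ge0 _) (hM (Ordinal l0)).
have lM0 : 0 <= l%:R * M by rewrite mulr_ge0.
have z1 : 1 <= modulus z by apply: le_trans hz; lra.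
rewrite monic_centered_horner.
have hs : modulus (\sum_(i < l) c 0 i * z ^+ i) <= l%:R * M * modulus z ^+ l.
  apply: le_trans (modulus_sum _) _.
  apply: le_trans (_ : \sum_(i < l) M * modulus z ^+ l <= _); last first.
    by rewrite sumr_const card_ord -[X in X <= _]mulr_natl mulrA.
  apply: ler_sum => i _; rewrite modulusM modulusX.
  by apply: ler_pM; rewrite ?exprn_ge0 ?modulus_ge0 //; apply: ler_weXn2l => //; exact: ltnW.
have h1 := modulus_sub_ge (z ^+ l.+1) (- \sum_(i < l) c 0 i * z ^+ i).
rewrite opprK modulusN modulusX exprS in h1.
have h2 : modulus z <= modulus z ^+ l by rewrite -{1}(expr1 (modulus z)) ler_weXn2l.
nra.
Qed.

Lemma escape_iterate z n : r <= modulus z ->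
  2 ^+ n * modulus z <= modulus (iterate p n z) /\ r <= modulus (iterate p n z).
Proof.
move=> hz; elim: n => [|n [IH1 IH2]]; first by rewrite expr0 mul1r.
have := escape_step IH2; rewrite -/(iterate p n.+1 z) => h.
have r0 : 0 <= modulus (iterate p n z) by exact: modulus_ge0.
by split; [rewrite exprS; lra|lra].
Qed.

Lemma escape_filled_julia z : filled_julia p z -> modulus z < r.
Proof.
move=> /filled_juliaP[B hB]; rewrite ltNge; apply/negP => hz.
have M0 : 0 <= M by exact: le_trans (modulus_ge0 _) (hM (Ordinal l0)).
have lM0 : 0 <= l%:R * M by rewrite mulr_ge0.
have [n hn] : exists n : nat, B < n%:R.
  by exists (Num.truncn B).+1; exact: truncnS_gt.
have [h _] := escape_iterate n hz.
have h2 : (n%:R : R) <= 2 ^+ n by rewrite -natrX ler_nat ltnW // ltn_expl.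
have h3 : 2 ^+ n <= 2 ^+ n * modulus z by rewrite ler_peMr ?exprn_ge0 //; lra.
by have := hB n; lra.
Qed.

Lemma escape_julia z : julia p z -> modulus z <= r.
Proof.
move=> /juliaP h; rewrite leNgt; apply/negP => hz.
have [|[y Ky hy] _] := h (modulus z - r); first by lra.
have := escape_filled_julia Ky; have := modulus_sub_ge z y.
by rewrite modulusBC; lra.
Qed.

End Escape.

(** * Cells of the grid *)
Section Grid.
Variables (R : realType) (l A N : nat).
Local Notation N1 := (N.+1%:R : R).
Local Notation B := ((box l A)%:R : R).

Lemma mesh_gt0 : 0 < N1^-1. Proof. by rewrite invr_gt0 ltr0n. Qed.

Lemma mesh_le1 : N1^-1 <= 1. Proof. by rewrite invf_le1 ?ltr0n // ler1n. Qed.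

Lemma node_cover (a : R) : `|a| <= B -> exists i : 'I_(side l A N),
  0 <= a - node R l A N i < N1^-1.
Proof.
rewrite ler_norml => /andP[a1 a2].
have a0 : 0 <= (a + B) * N1 by rewrite mulr_ge0 //; lra.
have /andP[h1 h2] := truncn_itv a0.
set n := Num.truncn _ in h1 h2.
have hn : (n < side l A N)%N.
  rewrite /side ltnS -(ler_nat R); apply: le_trans h1 _.
  by rewrite !natrM; apply: ler_wpM2r => //; lra.
exists (Ordinal hn); rewrite /node /=.
have -> : a - (n%:R / N1 - B) = ((a + B) * N1 - n%:R) / N1.
  by field; rewrite nat1r pnatr_eq0.
have i0 := mesh_gt0.
apply/andP; split; first by rewrite divr_ge0 ?subr_ge0.
by rewrite -[ltRHS]mul1r ltr_pM2r // ltrBlDr nat1r.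
Qed.

Lemma node_bound (i : 'I_(side l A N)) : `|node R l A N i| <= B.
Proof.
have := ltn_ord i; rewrite {2}/side ltnS -(ler_nat R) !natrM => h.
have h2 : i%:R / N1 <= 2 * B by rewrite ler_pdivrMr ?ltr0n.
have h3 : 0 <= i%:R / N1 by rewrite divr_ge0.
move: h2 h3; rewrite /node ler_norml; set y := _ / _ => h2 h3.
by apply/andP; split; lra.
Qed.

Lemma cell_bound (i j : 'I_(side l A N)) : modulus (cell R l A N i j) <= 2 * B.
Proof.
apply: le_trans (modulus_le_ReIm _) _ => /=.
by have := node_bound i; have := node_bound j; lra.
Qed.

(** Cells are open and overlap: their half-width is the full mesh. Hence a point
of a cell has a neighbourhood in the same cell, and cells cover the square. *)
Definition in_cell (z : C R) (i j : nat) : Prop :=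
  `|complex.Re z - node R l A N i| < N1^-1 /\
  `|complex.Im z - node R l A N j| < N1^-1.

Lemma in_cell_cover z : modulus z <= B ->
  exists i j : 'I_(side l A N), in_cell z i j.
Proof.
move=> hz.
have [i hi] := node_cover (le_trans (Re_le_modulus z) hz).
have [j hj] := node_cover (le_trans (Im_le_modulus z) hz).
case/andP: hi => a1 a2; case/andP: hj => b1 b2.
by exists i, j; split; rewrite ger0_norm.
Qed.

Lemma in_cell_dist z i j : in_cell z i j ->
  modulus (z - cell R l A N i j) <= 2 / N1.
Proof.
move=> [h1 h2]; apply: le_trans (modulus_le_ReIm _) _.
move: h1 h2; rewrite ReB ImB /=; set n := N1^-1 => h1 h2; lra.
Qed.

End Grid.

Lemma size_deriv_monic_centered (R : realType) l (c : 'rV[C R]_l) :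
  (size (@monic_centered R l.+1 c)^`() <= l.+2)%N.
Proof.
apply/leq_sizeP => i hi; rewrite coef_deriv nth_default ?mul0rn //.
by apply: leq_trans (size_monic_centered c) _; exact: leqW.
Qed.

(** * Rounding errors on cells *)
Section Estimates.
Variables (R : realType) (l : nat) (c : 'rV[C R]_l).
Variables (v : 'rV[rat]_(l + l)) (A N : nat).
Hypothesis l0 : (0 < l)%N.
Hypothesis hv : bounded_entries R A v.
Local Notation N1 := (N.+1%:R : R).
Local Notation B := ((box l A)%:R : R).
Local Notation D := ((2 * box l A + 2)%:R : R).
Local Notation M := ((2 * A + 2)%:R : R).
Local Notation p := (@monic_centered R l.+1 c).
Local Notation q := (approx_poly R v).
Hypothesis hc : forall i, modulus (c 0 i - approximant R v 0 i) <= 2 / N1.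

Lemma approximant_modulus i : modulus (approximant R v 0 i) <= 2 * A%:R.
Proof.
apply: le_trans (modulus_le_ReIm _) _; rewrite !mxE /=.
move: hv => /forallP h.
have := h (lshift l i); have := h (rshift l i).
by rewrite -!ler_norml; lra.
Qed.

Lemma approximant_bound i : modulus (approximant R v 0 i) <= M.
Proof. by rewrite (le_trans (approximant_modulus i)) // -natrM ler_nat leq_addr. Qed.

Lemma coefficient_bound i : modulus (c 0 i) <= M.
Proof.
rewrite -(subrK (approximant R v 0 i) (c 0 i)).
apply: le_trans (modulusD _ _) _.
have := hc i; have := mesh_le1 R N; have := approximant_modulus i.
by rewrite natrD natrM; set n := N1^-1; lra.
Qed.

Lemma spread_ge1 : (1 <= spread l A)%N.
Proof.
have h1 : (0 < 2 * A + 2)%N by lia.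
have h2 : (0 < (2 * box l A + 2) ^ l.+2)%N by rewrite expn_gt0 addn2.
by rewrite /spread muln_gt0 h2 andbT !muln_gt0 h1.
Qed.

Lemma spread_margin : (spread l A)%:R * (2 / N1) <= (slack l A)%:R / N1.
Proof.
rewrite mulrA; apply: ler_wpM2r; first exact: ltW (mesh_gt0 R N).
rewrite -natrM ler_nat /slack; have := spread_ge1; nia.
Qed.

Lemma spreadE : (spread l A)%:R = l.+1%:R * l.+2%:R ^+ 2 * M * D ^+ l.+2 :> R.
Proof. by rewrite /spread 3!natrM !natrX. Qed.

Let M1 : 1 <= M. Proof. by rewrite ler1n addn2. Qed.
Let D1 : 1 <= D. Proof. by rewrite ler1n addn2. Qed.
Let e0 : 0 <= 2 / N1 :> R. Proof. by rewrite divr_ge0. Qed.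

Lemma value_close z w : modulus z <= D -> modulus w <= D ->
  modulus (z - w) <= 2 / N1 -> modulus (p.[z] - q.[w]) <= (slack l A)%:R / N1.
Proof.
move=> hz hw hzw; apply: le_trans spread_margin; rewrite spreadE.
apply: le_trans (@horner_perturbation _ l.+2 M D (2 / N1) _ _ _ _ _ _ _ _ _ _ _ _) _ => //.
- exact: size_monic_centered.
- exact: size_monic_centered.
- by move=> i; apply: coef_bound => //; exact: approximant_bound.
- move=> i; apply: le_trans (coef_close hc e0 i) _.
  by rewrite ler_peMl.
apply: ler_wpM2r => //; apply: ler_wpM2r; first by rewrite exprn_ge0.
apply: ler_wpM2r => //; rewrite ler_peMl ?exprn_ge0 //.
by rewrite ler1n.
Qed.

Lemma multiplier_close z w : modulus z <= D -> modulus w <= D ->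
  modulus (z - w) <= 2 / N1 ->
  `|modulus p^`().[z] ^+ 2 - modulus q^`().[w] ^+ 2| <= (slack l A)%:R / N1.
Proof.
move=> hz hw hzw.
have M'1 : forall i, modulus q`_i <= M.
  by move=> i; apply: coef_bound => //; exact: approximant_bound.
have Mp : forall i, modulus p`_i <= M.
  by move=> i; apply: coef_bound => //; exact: coefficient_bound.
have h1 : modulus (p^`().[z] - q^`().[w]) <= (spread l A)%:R * (2 / N1).
  rewrite spreadE.
  apply: le_trans (@horner_perturbation _ l.+2 (l.+1%:R * M) D (2 / N1) _ _ _ _ _ _ _ _ _ _ _ _) _ => //.
  - exact: size_deriv_monic_centered.
  - exact: size_deriv_monic_centered.
  - by move=> i; exact: coef_deriv_monic_centered.
  - move=> i; apply: le_trans (coef_deriv_close hc e0 i) _.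
    by rewrite -mulrA ler_wpM2l // ler_peMl.
  by rewrite le_eqVlt; apply/orP; left; apply/eqP; ring.
have bound (P : {poly C R}) u : (size P <= l.+2)%N ->
    (forall i, modulus P`_i <= l.+1%:R * M) -> modulus u <= D ->
    modulus P.[u] <= (spread l A)%:R.
  move=> sP hP hu; apply: le_trans (horner_bound sP D1 hP hu) _.
  rewrite spreadE mulrA; apply: ler_wpM2r; first by rewrite exprn_ge0.
  apply: ler_wpM2r => //; rewrite mulrC; apply: ler_wpM2l => //.
  by rewrite -natrX ler_nat; nia.
apply: le_trans (modulus_sqrB _ _) _.
have b1 : modulus p^`().[z] <= (spread l A)%:R.
  apply: bound => //; last by move=> i; exact: coef_deriv_monic_centered.
  exact: size_deriv_monic_centered.
have b2 : modulus q^`().[w] <= (spread l A)%:R.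
  apply: bound => //; last by move=> i; exact: coef_deriv_monic_centered.
  exact: size_deriv_monic_centered.
apply: le_trans (_ : (spread l A)%:R * (2 / N1) * (2 * (spread l A)%:R) <= _).
  by apply: ler_pM; rewrite ?addr_ge0 ?modulus_ge0 //; lra.
by rewrite le_eqVlt; apply/orP; left; apply/eqP; rewrite /slack natrM natrX; ring.
Qed.

Lemma boxE : B = l%:R * M + 2 + 1.
Proof. by rewrite /box natrD natrM; lra. Qed.

Lemma box_julia z : julia p z -> modulus z <= B.
Proof. by move=> /(escape_julia l0 coefficient_bound); rewrite boxE; lra. Qed.

Lemma box_filled_julia z : filled_julia p z -> modulus z <= B - 1.
Proof. by move=> /(escape_filled_julia l0 coefficient_bound); rewrite boxE; lra. Qed.

Lemma in_cell_bound z (i j : 'I_(side l A N)) : in_cell l A N z i j ->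
  modulus z <= D.
Proof.
move=> h; have := modulusD (z - cell R l A N i j) (cell R l A N i j); rewrite subrK.
move: (in_cell_dist h) (cell_bound R i j) (mesh_le1 R N).
by rewrite natrD natrM; set n := N1^-1; lra.
Qed.

Lemma value_in_cell z (i j : 'I_(side l A N)) : in_cell l A N z i j ->
  modulus (p.[z] - q.[cell R l A N i j]) <= (slack l A)%:R / N1.
Proof.
move=> h; apply: value_close; last exact: in_cell_dist.
  exact: in_cell_bound h.
by have := cell_bound R i j; rewrite natrD natrM; lra.
Qed.

(** Arrows record every transition between cells that p may make. *)
Lemma arrow_in_cell z (i j i' j' : 'I_(side l A N)) x :
  in_cell l A N z i j -> in_cell l A N p.[z] i' j' ->
  arrow R (x, v) A N i j i' j'.
Proof.
move=> /value_in_cell h [h1 h2]; have := Re_le_modulus (p.[z] - q.[cell R l A N i j]).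
have := Im_le_modulus (p.[z] - q.[cell R l A N i j]); rewrite ReB ImB.
have E : (slack l A).+1%:R / N1 = (slack l A)%:R / N1 + N1^-1.
  by rewrite -[(slack l A).+1%:R]natr1 mulrDl mul1r.
move: h1 h2 h; rewrite !ltr_norml /arrow /nearby E /=.
set s := _ / N1; set n := N1^-1.
move=> /andP[a1 a2] /andP[b1 b2] h hI hR.
have := le_trans hI h; have := le_trans hR h; rewrite !ler_norml.
move=> /andP[d1 d2] /andP[f1 f2].
by apply/andP; split; apply/andP; split; lra.
Qed.

Lemma cell_disc (i j : 'I_(side l A N)) : modulus (cell R l A N i j) <= D.
Proof. by have := cell_bound R i j; rewrite natrD natrM; lra. Qed.

Lemma value_at_cell (i j : 'I_(side l A N)) :
  modulus (p.[cell R l A N i j] - q.[cell R l A N i j]) <= (slack l A)%:R / N1.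
Proof. by apply: value_close; rewrite ?cell_disc // subrr modulus0. Qed.

(** Conversely, arrows are pseudo-orbits of p whose error is of the order of the
mesh. *)
Lemma arrow_dist x (i j i' j' : 'I_(side l A N)) :
  arrow R (x, v) A N i j i' j' ->
  modulus (cell R l A N i' j' - p.[cell R l A N i j]) <=
    (3 * (slack l A)%:R + 2) / N1.
Proof.
have E : (slack l A).+1%:R / N1 = (slack l A)%:R / N1 + N1^-1.
  by rewrite -[(slack l A).+1%:R]natr1 mulrDl mul1r.
rewrite /arrow /nearby /= E.
have := value_at_cell i j.
rewrite [modulus (p.[_] - _)]modulusBC; set y := q.[_] => d1.
move=> /andP[/andP[a1 a2] /andP[a3 a4]].
have b1 : `|node R l A N i' - complex.Re y| <= (slack l A)%:R / N1 + N1^-1.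
  by rewrite ler_norml lerNl opprB !ltW.
have b2 : `|node R l A N j' - complex.Im y| <= (slack l A)%:R / N1 + N1^-1.
  by rewrite ler_norml lerNl opprB !ltW.
have := modulus_le_ReIm (cell R l A N i' j' - y).
have := modulus_trans (cell R l A N i' j') p.[cell R l A N i j] y.
have -> : (3 * (slack l A)%:R + 2) / N1 = 3 * ((slack l A)%:R / N1) + 2 * N1^-1.
  by rewrite mulrDl -mulrA.
rewrite ReB ImB /=; move: d1 b1 b2.
by set g := (slack l A)%:R / N1; set e := N1^-1; clear; lra.
Qed.

Lemma in_box_cell (i j : 'I_(side l A N)) : filled_julia p p.[cell R l A N i j] ->
  2 * ((slack l A)%:R / N1) <= 1 ->
  in_box l A N (complex.Re q.[cell R l A N i j]) &&
  in_box l A N (complex.Im q.[cell R l A N i j]).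
Proof.
move=> /box_filled_julia hz hs; have := value_at_cell i j.
rewrite [modulus (p.[_] - _)]modulusBC; set y := q.[_] => cl.
have hy := modulus_sub_ge y p.[cell R l A N i j].
have := Re_le_modulus y; have := Im_le_modulus y; rewrite /in_box !ler_norml.
move: hz hs cl hy; set g := (slack l A)%:R / N1; move: (modulus _) (modulus _) (modulus _).
by clear; move=> ? ? ? ? ? ? ? /andP[? ?] /andP[? ?];
  apply/andP; split; apply/andP; split; lra.
Qed.

Lemma expansion_ge x (i j : 'I_(side l A N)) :
  modulus p^`().[cell R l A N i j] ^+ 2 - 2 * ((slack l A)%:R / N1) <=
  expansion R (x, v) A N i j.
Proof.
rewrite /expansion -modulusE /=.
have := multiplier_close (cell_disc i j) (cell_disc i j).
rewrite subrr modulus0 => /(_ e0); rewrite ler_norml => /andP[_].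
by set g := _ / N1; lra.
Qed.

End Estimates.

(** * A valid certificate proves hyperbolicity *)
Section Soundness.
Variables (R : realType) (l : nat) (c : 'rV[C R]_l).
Variables (x : nat) (v : 'rV[rat]_(l + l)) (A N b : nat).
Hypothesis l0 : (0 < l)%N.
Local Notation N1 := (N.+1%:R : R).
Local Notation p := (@monic_centered R l.+1 c).
Local Notation q := (approx_poly R v).
Hypothesis hc : forall i, modulus (c 0 i - approximant R v 0 i) <= 2 / N1.
Hypothesis ok : valid R (x, v) A N b.

Local Notation kd := (kind l x A N b).
Local Notation vl := (value l x A N b).

Let hv : bounded_entries R A v. Proof. by case/andP: ok. Qed.

Let trap (i j : 'I_(side l A N)) : trap_ok R (x, v) A N b i j.
Proof. by case/andP: ok => _ /forallP/(_ i)/forallP/(_ j)/andP[]. Qed.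

Let arrows (i j i' j' : 'I_(side l A N)) : arrow R (x, v) A N i j i' j' ->
  arrow_ok R (x, v) A N b i j i' j'.
Proof.
case/andP: ok => _ /forallP/(_ i)/forallP/(_ j)/andP[_].
by move=> /forallP/(_ i')/forallP/(_ j')/implyP.
Qed.

Lemma trap_forward z (i j : 'I_(side l A N)) : in_cell l A N z i j ->
  kd i j = 0%N -> exists i' j' : 'I_(side l A N), in_cell l A N p.[z] i' j' /\
    kd i' j' = 0%N.
Proof.
move=> hz k0; have := trap i j; rewrite /trap_ok /= k0 eqxx /= => /andP[].
have h := value_in_cell l0 hv hc hz.
have hR := le_trans (Re_le_modulus _) h; have hI := le_trans (Im_le_modulus _) h.
move: hR hI; rewrite ReB ImB !ler_norml /in_box.
set s := _ / N1 => /andP[a1 a2] /andP[b1 b2] /andP[d1 d2] /andP[e1 e2].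
have [|i' hi] := @node_cover R l A N (complex.Re p.[z]).
  by rewrite ler_norml; apply/andP; split; lra.
have [|j' hj] := @node_cover R l A N (complex.Im p.[z]).
  by rewrite ler_norml; apply/andP; split; lra.
have hz' : in_cell l A N p.[z] i' j'.
  case/andP: hi => u1 u2; case/andP: hj => w1 w2.
  by split; rewrite ger0_norm.
exists i', j'; split=> //.
have /arrows/and3P[+ _ _] := arrow_in_cell l0 hv hc x hz hz'.
by rewrite /= k0 eqxx => /eqP.
Qed.

(** The orbit moves from one trap cell to another for ever, so it is bounded. *)
Lemma trap_filled_julia z (i j : 'I_(side l A N)) : in_cell l A N z i j ->
  kd i j = 0%N -> filled_julia p z.
Proof.
move=> hz k0.
have H n : exists i' j' : 'I_(side l A N), in_cell l A N (iterate p n z) i' j' /\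
    kd i' j' = 0%N.
  elim: n => [|n [i' [j' [h1 h2]]]]; first by exists i, j.
  exact: trap_forward h1 h2.
apply/filled_juliaP; exists (2 * box l A + 2)%:R => n.
have [i' [j' [h1 _]]] := H n; exact: in_cell_bound h1.
Qed.

(** The cell is an open set of bounded orbits. *)
Lemma julia_not_trap z (i j : 'I_(side l A N)) : julia p z ->
  in_cell l A N z i j -> kd i j <> 0%N.
Proof.
move=> /juliaP hJ [h1 h2] k0.
(* the room between [z] and the border of its cell *)
pose e := Num.min (N1^-1 - `|complex.Re z - node R l A N i|)
  (N1^-1 - `|complex.Im z - node R l A N j|).
have e0 : 0 < e by rewrite lt_min !subr_gt0 h1.
have [_ [y Ky]] := hJ e e0; rewrite lt_min => /andP[y1 y2]; apply: Ky.
apply: (@trap_filled_julia y i j) => //; split.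
  have := Re_le_modulus (y - z); rewrite ReB => hh.
  have := ler_distD (complex.Re z) (complex.Re y) (node R l A N i).
  by move: y1; set n := N1^-1; lra.
have := Im_le_modulus (y - z); rewrite ImB => hh.
have := ler_distD (complex.Im z) (complex.Im y) (node R l A N j).
by move: y2; set n := N1^-1; lra.
Qed.

Lemma julia_cell z : julia p z ->
  exists i j : 'I_(side l A N), in_cell l A N z i j.
Proof. by move=> /(box_julia l0 hv hc); exact: in_cell_cover. Qed.

Lemma value_bound i j : (vl i j <= b)%N.
Proof.
apply: leq_trans (leq_div _ _) _.
by rewrite -ltnS /label ltn_mod.
Qed.

(** The orbit stays in the Julia set, hence in the square, and the values would
increase for ever although digits are at most [b]. *)
Lemma julia_not_escape z (i j : 'I_(side l A N)) : julia p z ->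
  in_cell l A N z i j -> kd i j <> 1%N.
Proof.
move=> hJ hz k1.
have H n : exists i' j' : 'I_(side l A N),
    [/\ in_cell l A N (iterate p n z) i' j', kd i' j' = 1%N & (n <= vl i' j')%N].
  elim: n => [|n [i' [j' [h1 h2 h3]]]]; first by exists i, j.
  have hJ' := julia_iterate n.+1 hJ.
  have [i2 [j2 h4]] := julia_cell hJ'; exists i2, j2.
  have /arrows/and3P[_ + _] := arrow_in_cell l0 hv hc x h1 h4.
  by rewrite /= h2 eqxx /= => /andP[/eqP k2 hlt]; split=> //; exact: leq_ltn_trans h3 hlt.
have [i' [j' [_ _ h]]] := H b.+1.
by have := value_bound i' j'; rewrite leqNgt h.
Qed.

Lemma julia_kind z (i j : 'I_(side l A N)) : julia p z ->
  in_cell l A N z i j -> kd i j = 2%N.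
Proof.
move=> hJ hz; have := julia_not_trap hJ hz; have := julia_not_escape hJ hz.
have : (kd i j < 3)%N by rewrite ltn_mod.
by case: (kd i j) => [|[|[|]]].
Qed.

Lemma julia_expansion z (i j i' j' : 'I_(side l A N)) : julia p z ->
  in_cell l A N z i j -> in_cell l A N p.[z] i' j' ->
  (vl i j).+2%:R <= modulus p^`().[z] ^+ 2 * (vl i' j').+1%:R.
Proof.
move=> hJ hz hz'; have hJ' := julia_horner hJ.
have /arrows/and3P[_ _] := arrow_in_cell l0 hv hc x hz hz'.
rewrite /= (julia_kind hJ hz) (julia_kind hJ' hz') eqxx /= => h.
apply: le_trans h _; apply: ler_wpM2r => //.
rewrite /expansion -modulusE /=.
have := multiplier_close l0 hv hc (in_cell_bound hz) (cell_disc R i j)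
  (in_cell_dist hz).
rewrite ler_norml => /andP[+ _]; set s := _ / N1; lra.
Qed.

(** As values are at most [b], the gain from r + 1 to r + 2 in [julia_expansion]
is at least by the factor [L] = 1 + 1/(b + 1). The certificate controls the
squared derivative, whence the square roots. *)
Lemma valid_hyperbolic : hyperbolic p.
Proof.
pose b1 : R := b.+1%:R; pose L := 1 + b1^-1.
have b1gt : 0 < b1 by rewrite ltr0n.
have L1 : 1 < L by rewrite ltrDl invr_gt0.
have step z (i j i' j' : 'I_(side l A N)) : julia p z ->
    in_cell l A N z i j -> in_cell l A N p.[z] i' j' ->
    L * (vl i j).+1%:R <= modulus p^`().[z] ^+ 2 * (vl i' j').+1%:R.
  move=> hJ h1 h2; apply: le_trans (julia_expansion hJ h1 h2).
  have h : b1^-1 * (vl i j).+1%:R <= 1.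
    by rewrite ler_pdivrMl // mulr1 ler_nat ltnS value_bound.
  by rewrite -[leRHS]natr1 /L mulrDl mul1r lerD2l.
have H z (i j : 'I_(side l A N)) n : julia p z -> in_cell l A N z i j ->
  exists i' j' : 'I_(side l A N), in_cell l A N (iterate p n z) i' j' /\
    L ^+ n * (vl i j).+1%:R <= modulus (multiplier p n z) ^+ 2 * (vl i' j').+1%:R.
  move=> hJ hz; elim: n => [|n [i' [j' [h1 h2]]]].
    by exists i, j; rewrite multiplier0 modulus1 expr1n expr0.
  have hJ' := julia_iterate n hJ.
  have [i2 [j2 h3]] := julia_cell (julia_horner hJ').
  exists i2, j2; split=> //; have h4 := step _ _ _ _ _ hJ' h1 h3.
  rewrite multiplierS modulusM exprMn exprS -mulrA.
  apply: le_trans (_ : L * (modulus (multiplier p n z) ^+ 2 * (vl i' j').+1%:R) <= _).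
    by rewrite ler_pM2l //; lra.
  rewrite mulrCA [leRHS]mulrAC [leRHS]mulrC.
  by apply: ler_wpM2l => //; rewrite exprn_ge0 // modulus_ge0.
exists (Num.sqrt b1^-1), (Num.sqrt L); split.
- by rewrite sqrtr_gt0 invr_gt0.
- by rewrite -[ltLHS]sqrtr1 ltr_sqrt //; lra.
move=> z hJ n; rewrite -/(modulus _) -/(multiplier p n z).
have [i [j hz]] := julia_cell hJ; have [i' [j' [_ h]]] := H z i j n hJ hz.
rewrite -(@ler_pXn2r _ 2) ?nnegrE ?modulus_ge0 ?mulr_ge0 ?exprn_ge0 ?sqrtr_ge0 //.
rewrite exprMn -exprM mulnC exprM !sqr_sqrtr ?invr_ge0; [|lra|exact: ltW].
rewrite ler_pdivrMl //.
have Ln : 0 <= L ^+ n by rewrite exprn_ge0 //; lra.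
apply: le_trans (_ : L ^+ n * (vl i j).+1%:R <= _).
  by rewrite ler_peMr // ler1n.
apply: le_trans h _; rewrite mulrC; apply: ler_wpM2r.
  by rewrite exprn_ge0 // modulus_ge0.
by rewrite ler_nat ltnS value_bound.
Qed.

End Soundness.

(** * Preimages near a point *)
Section RootsNear.
Variables (R : realType) (l : nat) (c : 'rV[C R]_l).
Local Notation p := (@monic_centered R l.+1 c).

Lemma exists_le_prod (I : eqType) (s : seq I) (f : I -> R) : s != [::] ->
  (forall i, 0 <= f i) ->
  exists2 i, i \in s & f i ^+ size s <= \prod_(i <- s) f i.
Proof.
move=> + f0; elim: s => // a [|b s] IH _.
  by exists a; rewrite ?inE ?eqxx // big_seq1.
have [//|i is0 hi] := IH; rewrite big_cons (_ : size (a :: b :: s) = (size (b :: s)).+1) //.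
have [fai|fai] := leP (f a) (f i).
  exists a; rewrite ?inE ?eqxx // exprS; apply: ler_wpM2l => //.
  by apply: le_trans hi; apply: lerXn2r; rewrite ?nnegrE.
exists i; first by rewrite inE is0 orbT.
rewrite exprS.
apply: ler_pM => //; rewrite ?exprn_ge0 //; exact: ltW.
Qed.

(** The product of the distances from [z] to the solutions of p(z') = w is
|p(z) - w|, so the smallest of these l + 1 distances is not larger than its
(l + 1)-th root. *)
Lemma preimage_near z w : exists2 z', p.[z'] = w &
  modulus (z - z') ^+ l.+1 <= modulus (p.[z] - w).
Proof.
pose P := p - w%:P.
have coefP : P`_l.+1 = 1.
  by rewrite coefB coefC /= subr0 monic_centered_coef_high // eqxx.
have sP : size P = l.+2.
  apply/anti_leq/andP; split; last first.
    rewrite ltnNge; apply/negP => /leq_sizeP/(_ l.+1 (leqnn _)).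
    by rewrite coefP => /eqP; rewrite oner_eq0.
  apply: leq_trans (size_polyD _ _) _; rewrite geq_max size_monic_centered /=.
  by rewrite size_polyN (leq_trans (size_polyC_leq1 _)).
have leadP : lead_coef P = 1 by rewrite lead_coefE sP.
have [rs Prs] := closed_field_poly_normal P.
rewrite leadP scale1r in Prs.
have srs : size rs = l.+1.
  by apply/eqP; rewrite -eqSS -(size_prod_XsubC rs id) -Prs sP.
have PE u : p.[u] - w = \prod_(r <- rs) (u - r).
  have -> : p.[u] - w = P.[u] by rewrite [RHS]hornerD hornerN hornerC.
  by rewrite Prs horner_prod; apply: eq_bigr => r _; rewrite hornerXsubC.
have [||r rrs hr] := @exists_le_prod _ rs (fun r => modulus (z - r)).
- by rewrite -size_eq0 srs.
- by move=> r; exact: modulus_ge0.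
exists r; last by rewrite PE modulus_prod -srs.
apply/eqP; rewrite -subr_eq0 PE prodf_seq_eq0; apply/hasP.
by exists r => //=; rewrite subrr eqxx.
Qed.

(** Points near p(z) have preimages near [z], and the two kinds of orbits are
preserved by passing to a preimage. *)
Lemma julia_preimage z : julia p p.[z] -> julia p z.
Proof.
move=> /juliaP h; apply/juliaP => e e0.
have H y : modulus (y - p.[z]) < e ^+ l.+1 -> exists2 z', p.[z'] = y & modulus (z' - z) < e.
  move=> hy; have [z' E hz'] := preimage_near z y; exists z' => //.
  rewrite modulusBC -(@ltr_pXn2r _ l.+1) ?nnegrE ?modulus_ge0 ?ltW //.
  by apply: le_lt_trans hz' _; rewrite modulusBC.
have [[y Ky /H[z' E hz']] [y' Ky' /H[z2 E2 hz2]]] := h (e ^+ l.+1) (exprn_gt0 _ e0).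
split; [exists z' => //|exists z2 => //].
  by apply/filled_julia_horner; rewrite E.
by move=> /filled_julia_horner; rewrite E2.
Qed.

End RootsNear.

(** * Boundary points on segments *)
Section Segment.
Variables (R : realType) (p : {poly C R}).

(** The supremum, along the segment, of the points with bounded orbits: such points
accumulate at it from one side, and escaping ones from the other. *)
Lemma julia_between y y' : filled_julia p y -> ~ filled_julia p y' ->
  exists2 w, julia p w & modulus (w - y) <= modulus (y' - y) /\
    modulus (w - y') <= modulus (y' - y).
Proof.
move=> Ky Ky'; pose f (t : R) : C R := y + t%:C%C * (y' - y).
have f_dist t s : modulus (f t - f s) = `|t - s| * modulus (y' - y).
  have -> : f t - f s = (t - s)%:C%C * (y' - y) by rewrite /f rmorphB; ring.
  rewrite modulusM; congr (_ * _).
  by rewrite /modulus /= expr0n addr0 sqrtr_sqr.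
have f0 : f 0 = y by rewrite /f mul0r addr0.
have f1 : f 1 = y' by rewrite /f mul1r addrC subrK.
(* parameters of the points of the segment with bounded orbits *)
pose S := [set t : R | 0 <= t <= 1 /\ filled_julia p (f t)].
have S0 : S 0 by split; [rewrite lexx ler01|rewrite f0].
have Sub : ubound S 1 by move=> t [/andP[]].
have supS : has_sup S by split; [exists 0|exists 1].
pose s := sup S.
have s0 : 0 <= s by apply: ub_le_sup => //; exists 1.
have s1 : s <= 1 by apply: ge_sup => //; exists 0.
exists (f s); last first.
  have m0 := modulus_ge0 (y' - y).
  have d0 := f_dist s 0; have d1 := f_dist s 1; rewrite f0 in d0; rewrite f1 in d1.
  by split; rewrite ?d0 ?d1 ler_piMl // ler_norml; apply/andP; split; lra.
have m1 : 0 < modulus (y' - y) + 1 by have := modulus_ge0 (y' - y); lra.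
apply/juliaP => e e0; pose e' := e / (modulus (y' - y) + 1).
have e'0 : 0 < e' by rewrite divr_gt0.
have close t : `|t - s| < e' -> modulus (f t - f s) < e.
  move=> h; rewrite f_dist; move: h; rewrite /e' ltr_pdivlMr //.
  apply: le_lt_trans; apply: ler_wpM2l => //; lra.
split.
  have [t [/andP[t0 t1] Kt] ht] := sup_adherent e'0 supS.
  exists (f t) => //; apply: close.
  have ts : t <= s by apply: ub_le_sup; [exists 1|split=> //; rewrite t0].
  by rewrite ltr_norml; apply/andP; split; move: ht; rewrite -/s; lra.
have [s_lt1|] := ltP s 1; last first.
  move=> h; have -> : s = 1 by apply/eqP; rewrite eq_le s1.
  by exists y' => //; rewrite f1 subrr modulus0.
pose t := Num.min 1 (s + e' / 2).
have st : s < t by rewrite lt_min s_lt1 /= ltrDl divr_gt0.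
have t1 : t <= 1 by rewrite ge_min lexx.
have te : t <= s + e' / 2 by rewrite ge_min lexx orbT.
exists (f t).
  move=> Kt; have : t <= s by apply: ub_le_sup; [exists 1|split=> //; apply/andP; split; lra].
  by rewrite leNgt st.
by apply: close; rewrite ger0_norm; lra.
Qed.

End Segment.

(** * Telescoping sums along orbits *)
Section SumOfSquares.
Variable R : realType.
Implicit Types P : nat -> {poly C R}.

Definition sumsq P n (z : C R) : R := \sum_(j < n) modulus (P j).[z] ^+ 2.

Lemma sumsq_ge0 P n z : 0 <= sumsq P n z.
Proof. by apply: sumr_ge0 => j _; rewrite sqr_ge0. Qed.

Lemma sqr_lipschitz (P : {poly C R}) (D : R) : exists2 L, 0 <= L &
  forall z q, modulus z <= D -> modulus q <= D ->
  `|modulus P.[z] ^+ 2 - modulus P.[q] ^+ 2| <= L * modulus (z - q).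
Proof.
have [L L0 hL] := horner_lipschitz P D; have [B B0 hB] := horner_bounded P D.
exists (L * (2 * B)) => [|z q hz hq]; first by rewrite !mulr_ge0.
apply: le_trans (modulus_sqrB _ _) _; rewrite mulrAC.
apply: ler_pM; rewrite ?addr_ge0 ?modulus_ge0 ?hL //.
by have := hB _ hz; have := hB _ hq; lra.
Qed.

Lemma sumsq_lipschitz P n (D : R) : exists2 L, 0 <= L &
  forall z q, modulus z <= D -> modulus q <= D ->
  `|sumsq P n z - sumsq P n q| <= L * modulus (z - q).
Proof.
elim: n => [|n [L L0 hL]].
  by exists 0 => // z q _ _; rewrite /sumsq !big_ord0 subrr normr0 mul0r.
have [L' L'0 hL'] := sqr_lipschitz (P n) D.
exists (L + L') => [|z q hz hq]; first exact: addr_ge0.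
rewrite /sumsq !big_ord_recr /= -!/(sumsq P n _) mulrDl.
have -> : sumsq P n z + modulus (P n).[z] ^+ 2 - (sumsq P n q + modulus (P n).[q] ^+ 2)
  = (sumsq P n z - sumsq P n q) + (modulus (P n).[z] ^+ 2 - modulus (P n).[q] ^+ 2) by ring.
by apply: le_trans (ler_normD _ _) _; apply: lerD; [exact: hL|exact: hL'].
Qed.

Lemma sumsq_bounded P n (D : R) : exists2 B, 1 <= B &
  forall z, modulus z <= D -> sumsq P n z <= B.
Proof.
have [L L0 hL] := sumsq_lipschitz P n (Num.max D 0).
exists (1 + sumsq P n 0 + L * Num.max D 0).
  have : 0 <= L * Num.max D 0 by rewrite mulr_ge0 // le_max lexx orbT.
  by have := sumsq_ge0 P n 0; lra.
move=> z hz; have /hL h : modulus z <= Num.max D 0 by rewrite le_max hz.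
have := h 0; rewrite modulus0 subr0 le_max lexx orbT => /(_ isT).
rewrite ler_norml => /andP[_ h2].
have : L * modulus z <= L * Num.max D 0 by apply: ler_wpM2l => //; rewrite le_max hz.
lra.
Qed.

Variable p : {poly C R}.

Lemma sum_shift n (f : nat -> R) :
  \sum_(j < n) f j.+1 = \sum_(j < n) f j - f 0%N + f n.
Proof.
have : \sum_(j < n.+1) f j = f 0%N + \sum_(j < n) f j.+1 by rewrite big_ord_recl.
by rewrite big_ord_recr /= => E; apply: (addrI (f 0%N)); rewrite -E; ring.
Qed.

(** The density of an adapted metric, squared: where |(p^n)'| > 1, the derivative
of p expands it in one step. *)
Definition weight n := sumsq (fun j => (iter_poly p j)^`()) n.

(** A function that increases along orbits which move away within n steps. *)
Definition height n := sumsq (iter_poly p) n.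

(** Multiplication by |p'(z)|^2 turns the derivative of p^j at p(z) into that of
p^(j+1) at z, so that the sum is shifted by one index. *)
Lemma weight_horner n z : weight n p.[z] * modulus p^`().[z] ^+ 2 =
  weight n z - 1 + modulus (multiplier p n z) ^+ 2.
Proof.
have -> : weight n p.[z] * modulus p^`().[z] ^+ 2 =
    \sum_(j < n) modulus (multiplier p j.+1 z) ^+ 2.
  rewrite /weight /sumsq mulr_suml; apply: eq_bigr => j _.
  by rewrite -/(multiplier p j _) multiplierSr modulusM exprMn.
rewrite (sum_shift n (fun j => modulus (multiplier p j z) ^+ 2)).
by rewrite multiplier0 modulus1 expr1n.
Qed.

Lemma weight_ge1 n z : 1 <= weight n.+1 z.
Proof.
rewrite /weight /sumsq big_ord_recl /= -/(multiplier p 0 z) multiplier0 modulus1.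
by rewrite expr1n lerDl sumr_ge0 // => j _; rewrite sqr_ge0.
Qed.

Lemma height_horner n z : height n p.[z] =
  height n z - modulus z ^+ 2 + modulus (iterate p n z) ^+ 2.
Proof.
have -> : height n p.[z] = \sum_(j < n) modulus (iterate p j.+1 z) ^+ 2.
  apply: eq_bigr => j _; rewrite iter_poly_horner.
  by rewrite /iterate iterSr.
have -> : height n z = \sum_(j < n) modulus (iterate p j z) ^+ 2.
  by apply: eq_bigr => j _; rewrite iter_poly_horner.
exact: (sum_shift n (fun j => modulus (iterate p j z) ^+ 2)).
Qed.

End SumOfSquares.

(** * Inequalities between real numbers *)
Section Small.
Variable R : realType.

Lemma small_factor (a b : R) : 0 <= a -> 0 < b ->
  exists2 e, 0 < e & forall x, 0 <= x <= e -> a * x <= b.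
Proof.
move=> a0 b0; have a1 : 0 < a + 1 by lra.
exists (b / (a + 1)) => [|x /andP[x0]]; first by rewrite divr_gt0.
rewrite ler_pdivlMr // => h.
by apply: le_trans h; rewrite mulrDr mulr1 mulrC; lra.
Qed.

Lemma exists_expr_ge (L K : R) : 1 < L -> exists n, K <= L ^+ n.+1.
Proof.
move=> L1; have bern n : 1 + n%:R * (L - 1) <= L ^+ n.
  elim: n => [|n IH]; first by rewrite mul0r addr0.
  rewrite exprS -natr1.
  have : 0 <= n%:R * (L - 1) ^+ 2 by rewrite mulr_ge0 // sqr_ge0.
  have : L * (1 + n%:R * (L - 1)) <= L * L ^+ n by rewrite ler_pM2l //; lra.
  by rewrite expr2; lra.
have L0 : 0 < L - 1 by lra.
exists (Num.truncn (K / (L - 1))); apply: le_trans (bern _).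
have := truncnS_gt (K / (L - 1)); rewrite ltr_pdivrMr // => h; lra.
Qed.

(** Here [s] is the distance of two points, [m] that of their images, [P1] the
modulus of the derivative and [T * s ^+ 2] the error of the linear
approximation. *)
Lemma taylor_defect (s m T P P1 : R) : 0 <= s -> s <= 1 -> 0 <= m -> 0 <= T ->
  0 <= P1 -> P1 <= P -> s * P1 <= m + T * s ^+ 2 -> m <= s * P1 + T * s ^+ 2 ->
  s ^+ 2 * P1 ^+ 2 <= m ^+ 2 + (2 * (P + T) * T + T ^+ 2) * s ^+ 3.
Proof.
move=> s0 s1 m0 T0 P10 P1P h2 h3.
have h4 : m <= s * (P + T).
  have : T * s ^+ 2 <= T * s by apply: ler_wpM2l => //; rewrite expr2 ler_piMr.
  have : s * P1 <= s * P by apply: ler_wpM2l.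
  by rewrite mulrDr; lra.
have a1 : (s * P1) ^+ 2 <= (m + T * s ^+ 2) ^+ 2.
  by apply: lerXn2r; rewrite ?nnegrE ?mulr_ge0 ?addr_ge0 ?mulr_ge0 ?sqr_ge0.
have a2 : m * (T * s ^+ 2) <= s * (P + T) * (T * s ^+ 2).
  by apply: ler_wpM2r => //; rewrite mulr_ge0 ?sqr_ge0.
have a3 : T ^+ 2 * s ^+ 3 * s <= T ^+ 2 * s ^+ 3.
  by rewrite ler_piMr // mulr_ge0 ?sqr_ge0 ?exprn_ge0.
rewrite -exprMn; apply: le_trans a1 _.
have -> : (m + T * s ^+ 2) ^+ 2 =
    m ^+ 2 + 2 * (m * (T * s ^+ 2)) + T ^+ 2 * s ^+ 3 * s by ring.
have -> : (2 * (P + T) * T + T ^+ 2) * s ^+ 3 =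
    2 * (s * (P + T) * (T * s ^+ 2)) + T ^+ 2 * s ^+ 3 by ring.
by move: a2 a3; clear; lra.
Qed.

(** The weights [a] at the images and [b] at the points satisfy an expansion
inequality with gain 1; as weights are at most [W], half of this gain survives
the error term and gives a factor 1 + 1/(2W). *)
Lemma weighted_gain (s m P1 K W a b : R) : 0 <= s -> 0 <= K -> 0 < W ->
  0 <= a -> a <= W -> b <= W -> s ^+ 2 * P1 ^+ 2 <= m ^+ 2 + K * s ^+ 3 ->
  b + 1 <= a * P1 ^+ 2 -> K * W * s <= 1 / 2 ->
  s ^+ 2 * b * (1 + 1 / (2 * W)) <= m ^+ 2 * a.
Proof.
move=> s0 K0 W0 a0 aW bW hd hb hK; have s20 : 0 <= s ^+ 2 by exact: sqr_ge0.
have h : s ^+ 2 * (b + 1 / 2) <= m ^+ 2 * a.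
  have b1 : s ^+ 2 * P1 ^+ 2 * a <= (m ^+ 2 + K * s ^+ 3) * a by apply: ler_wpM2r.
  have b2 : s ^+ 2 * (b + 1) <= s ^+ 2 * (a * P1 ^+ 2) by apply: ler_wpM2l.
  have b4 : K * s * a <= K * s * W by apply: ler_wpM2l => //; rewrite mulr_ge0.
  have b5 : s ^+ 2 * (K * s * a) <= s ^+ 2 * (1 / 2).
    by apply: ler_wpM2l => //; rewrite mulrAC in hK; exact: le_trans b4 hK.
  have e1 : s ^+ 2 * P1 ^+ 2 * a = s ^+ 2 * (a * P1 ^+ 2) by ring.
  have e2 : (m ^+ 2 + K * s ^+ 3) * a = m ^+ 2 * a + s ^+ 2 * (K * s * a) by ring.
  by move: b1 b2 b5 e1 e2; clear; lra.
apply: le_trans h; rewrite -mulrA; apply: ler_wpM2l => //.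
rewrite mulrDr mulr1 lerD2l mulrA mulr1 ler_pdivrMr ?mulr_gt0 //.
by move: bW; clear; lra.
Qed.

(** The weight is known up to [K * h] at a point [h]-close to the image, and the
squared derivative [Q] up to [2 * h]. *)
Lemma perturbed_gain (K h P Q W a a' b g X : R) : 0 <= K -> 0 <= h ->
  0 <= Q -> Q <= P -> 0 <= a' -> a' <= W -> a - K * h <= a' ->
  a * Q = b - 1 + g -> 7 / 4 <= g -> (K * P + 2 * W) * h <= 1 / 4 ->
  Q - 2 * h <= X -> b + 1 / 2 <= a' * X.
Proof.
move=> K0 h0 Q0 QP a'0 a'W haa' E hg hh hX.
have k1 : a' * (Q - 2 * h) <= a' * X by apply: ler_wpM2l.
have k2 : (a - K * h) * Q <= a' * Q by apply: ler_wpM2r.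
have k3 : K * h * Q <= K * h * P by apply: ler_wpM2l => //; rewrite mulr_ge0.
have k4 : a' * (2 * h) <= W * (2 * h) by apply: ler_wpM2r => //; rewrite mulr_ge0.
have e3 : (K * P + 2 * W) * h = K * h * P + W * (2 * h) by ring.
have e4 : (a - K * h) * Q = a * Q - K * h * Q by ring.
have e5 : a' * (Q - 2 * h) = a' * Q - a' * (2 * h) by ring.
by move: k1 k2 k3 k4 e3 e4 e5 E hg hh; clear; lra.
Qed.

End Small.

(** * The dynamics of a hyperbolic polynomial *)
Section Lyapunov.
Variables (R : realType) (l : nat) (c : 'rV[C R]_l) (M : R).
Hypotheses (l0 : (0 < l)%N) (hM : forall i, modulus (c 0 i) <= M).
Local Notation p := (@monic_centered R l.+1 c).
Local Notation r := (l%:R * M + 2).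

Let r2 : 2 <= r.
Proof.
have M0 : 0 <= M by exact: le_trans (modulus_ge0 _) (hM (Ordinal l0)).
by rewrite lerDr mulr_ge0.
Qed.

Lemma expanding_time : hyperbolic p ->
  exists n, forall z, julia p z -> 2 <= modulus (multiplier p n.+1 z) ^+ 2.
Proof.
move=> [K [L [K0 L1 h]]]; have [n hn] := exists_expr_ge (2 / K) L1.
exists n => z hz; have := h z hz n.+1.
rewrite -/(modulus _) -/(multiplier p n.+1 z) => h1.
have h2 : 2 <= K * L ^+ n.+1 by rewrite mulrC -ler_pdivrMr.
by have := le_trans h2 h1; set m := modulus _ => hm; rewrite expr2; nra.
Qed.

Variable n : nat.
Hypothesis hn : forall z, julia p z -> 2 <= modulus (multiplier p n.+1 z) ^+ 2.
Local Notation rho := (weight p n.+1).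

Lemma rho_julia z : julia p z -> rho z + 1 <= rho p.[z] * modulus p^`().[z] ^+ 2.
Proof. by move=> hz; rewrite weight_horner; have := hn hz; lra. Qed.

(** Inverse branches near the Julia set contract the weighted distance. The
preimage found by [preimage_near] is only known to be close, but then Taylor's
formula around it, where expansion is known exactly, gives the sharp factor. *)
Lemma contraction : exists2 m0, 0 < m0 & exists2 t, 0 < t &
  forall z w, julia p w -> modulus (p.[z] - w) <= m0 ->
  exists2 z', julia p z' &
    modulus (z - z') ^+ 2 * rho z' * (1 + t) <= modulus (p.[z] - w) ^+ 2 * rho w.
Proof.
have [T T0 hT] := horner_taylor p (r + 1).
have [P P0 hP] := horner_bounded p^`() (r + 1).
have [W W1 hW] := sumsq_bounded (fun j => (iter_poly p j)^`()) n.+1 (r + 1).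
(* error constant of [taylor_defect]; within distance [d] of the Julia set the
   error costs at most half of the gain *)
pose C0 := 2 * (P + T) * T + T ^+ 2.
have C00 : 0 <= C0 by rewrite addr_ge0 ?sqr_ge0 // !mulr_ge0 // addr_ge0.
have half : 0 < (1 / 2 : R) by lra.
have W0 : 0 <= W by lra.
have [e e0 he] := small_factor (mulr_ge0 C00 W0) half.
pose d := Num.min 1 e.
have d0 : 0 < d by rewrite lt_min ltr01.
have d1 : d <= 1 by rewrite ge_min lexx.
have de : d <= e by rewrite ge_min lexx orbT.
exists (d ^+ l.+1); first exact: exprn_gt0.
exists (1 / (2 * W)); first by rewrite divr_gt0 //; lra.
move=> z w Jw hzw; have [z' E hz'] := preimage_near c z w.
have Jz' : julia p z' by apply: (@julia_preimage R l c); rewrite E.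
exists z' => //.
set s := modulus (z - z') in hz' *; set m := modulus (p.[z] - w).
have s0 : 0 <= s by exact: modulus_ge0.
have m0 : 0 <= m by exact: modulus_ge0.
have sd : s <= d.
  by rewrite -(@ler_pXn2r _ l.+1) ?nnegrE //; [exact: le_trans hz' hzw|exact: ltW].
have z'r : modulus z' <= r + 1 by have := escape_julia l0 hM Jz'; lra.
have zr : modulus z <= r + 1.
  by have := modulus_sub_ge z z'; rewrite -/s; have := escape_julia l0 hM Jz'; lra.
have wr : modulus w <= r + 1 by have := escape_julia l0 hM Jw; lra.
have h1 := hT z z' zr z'r; rewrite E -/s in h1.
set P1 := modulus p^`().[z'].
have P10 : 0 <= P1 by exact: modulus_ge0.
have P1P : P1 <= P by exact: hP.
have h2 : s * P1 <= m + T * s ^+ 2.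
  have := modulus_sub_ge ((z - z') * p^`().[z']) (p.[z] - w).
  rewrite modulusM -/s -/P1 -/m [modulus (_ * _ - _)]modulusBC; lra.
have h3 : m <= s * P1 + T * s ^+ 2.
  have := modulus_sub_ge (p.[z] - w) ((z - z') * p^`().[z']).
  rewrite modulusM -/s -/P1 -/m; lra.
apply: (@weighted_gain _ s m P1 C0 W (rho w) (rho z')) => //; try lra.
- exact: sumsq_ge0.
- exact: hW.
- exact: hW.
- by apply: (taylor_defect (P := P)) => //; lra.
- by rewrite -E; exact: rho_julia.
by apply: he; rewrite s0 /=; lra.
Qed.

(** The neighbourhood of radius [e] of the Julia set in the adapted metric. *)
Definition vicinity e z := exists2 w, julia p w & modulus (z - w) ^+ 2 * rho w < e ^+ 2.

Lemma vicinity_dist e z : 0 < e -> vicinity e z ->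
  exists2 w, julia p w & modulus (z - w) < e /\ modulus (z - w) ^+ 2 * rho w < e ^+ 2.
Proof.
move=> e0 [w Jw h]; exists w => //; split=> //.
rewrite -(@ltr_pXn2r _ 2) ?nnegrE ?modulus_ge0 ?ltW //.
apply: le_lt_trans h; rewrite ler_peMr ?sqr_ge0 //; exact: weight_ge1.
Qed.

(** The room gained by [contraction] absorbs a perturbation of the image. *)
Lemma vicinity_backward : exists2 e1, 0 < e1 & forall e, 0 < e <= e1 ->
  exists2 h, 0 < h & forall z q, modulus (q - p.[z]) <= h -> vicinity e q -> vicinity e z.
Proof.
have [m0 m00 [t t0 H]] := contraction.
have [W W1 hW] := sumsq_bounded (fun j => (iter_poly p j)^`()) n.+1 r.
have mh : 0 < m0 / 2 by rewrite divr_gt0.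
exists (m0 / 2) => // e /andP[e0 em].
have te : 0 < t * e ^+ 2 by rewrite mulr_gt0 // exprn_gt0.
have a0 : 0 <= 3 * e * W by rewrite !mulr_ge0 //; lra.
have [h1 h10 hh] := small_factor a0 te.
(* [h <= h1] spends the room [t * e ^+ 2]; the other bounds keep the perturbed
   point in the range [m0] of [contraction] *)
pose h := Num.min h1 (Num.min e (m0 / 2)).
have h0 : 0 < h by rewrite !lt_min h10 e0 mh.
have hh1 : h <= h1 by rewrite ge_min lexx.
have he : h <= e by rewrite !ge_min lexx orbT.
have hm : h <= m0 / 2 by rewrite !ge_min lexx !orbT.
exists h => // z q hq vq.
have [w Jw [qw qw2]] := vicinity_dist e0 vq.
have d : modulus (p.[z] - w) <= modulus (q - w) + h.
  have := modulus_trans p.[z] w q; rewrite [modulus (p.[z] - q)]modulusBC; lra.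
have [|z' Jz' hz'] := H z w Jw; first by lra.
exists z' => //.
have t1 : 0 < 1 + t by lra.
rewrite -(ltr_pM2r t1); apply: le_lt_trans hz' _.
set a := modulus (q - w) in qw qw2 d.
have rw1 : 1 <= rho w by exact: weight_ge1.
have rwW : rho w <= W by apply: hW; exact: (escape_julia l0 hM Jw).
have a00 : 0 <= a by exact: modulus_ge0.
have s1 : modulus (p.[z] - w) ^+ 2 <= (a + h) ^+ 2.
  by apply: lerXn2r; rewrite ?nnegrE ?modulus_ge0 //; lra.
have s2 : modulus (p.[z] - w) ^+ 2 * rho w <= (a + h) ^+ 2 * rho w.
  by apply: ler_wpM2r => //; lra.
have s3 : (2 * a + h) * h * rho w <= 3 * e * W * h.
  have -> : 3 * e * W * h = 3 * e * h * W by ring.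
  apply: ler_pM => //; rewrite ?mulr_ge0 //; try lra.
  by apply: ler_wpM2r; lra.
have s4 : 3 * e * W * h <= t * e ^+ 2 by apply: hh; rewrite ltW.
have -> : e ^+ 2 * (1 + t) = e ^+ 2 + t * e ^+ 2 by ring.
have e1 : (a + h) ^+ 2 * rho w = a ^+ 2 * rho w + (2 * a + h) * h * rho w by ring.
lra.
Qed.

Lemma vicinity_julia e : 0 < e -> exists2 h, 0 < h &
  forall z w, julia p w -> modulus (z - w) <= h -> vicinity e z.
Proof.
move=> e0; have [W W1 hW] := sumsq_bounded (fun j => (iter_poly p j)^`()) n.+1 r.
exists (e / (W + 1)) => [|z w Jw hzw]; first by rewrite divr_gt0 //; lra.
exists w => //; have rw1 : 1 <= rho w by exact: weight_ge1.
have rwW : rho w <= W by apply: hW; exact: (escape_julia l0 hM Jw).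
have W0 : 0 < W + 1 by lra.
move: hzw; rewrite ler_pdivlMr // => hzw.
set a := modulus (z - w) in hzw *; have a0 : 0 <= a by exact: modulus_ge0.
have [->|an0] := eqVneq a 0; first by rewrite expr0n mul0r exprn_gt0.
have a1 : 0 < a by rewrite lt_def an0.
have : (a * (W + 1)) ^+ 2 <= e ^+ 2.
  by apply: lerXn2r; rewrite ?nnegrE ?mulr_ge0 //; lra.
apply: lt_le_trans; rewrite exprMn ltr_pM2l ?exprn_gt0 //.
by rewrite expr2; nra.
Qed.

(** Each point has a neighbourhood in which one of the cases holds for all large
[T]: an unbounded orbit gets far away together with its neighbours, a point in
the interior of the filled Julia set has bounded neighbours, and a boundary point
has neighbours in the vicinity. Compactness of the square makes [T] uniform. *)
Lemma uniform_escape (Bd e : R) : 0 < e -> r <= Bd -> exists T, forall z,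
  modulus z <= Bd -> [\/ filled_julia p z, vicinity e z |
    Bd + 1 <= modulus (iterate p T z)].
Proof.
move=> e0 rB.
pose good T z := [\/ filled_julia p z, vicinity e z | Bd + 1 <= modulus (iterate p T z)].
(* beyond the escape radius the modulus increases *)
have mono T T' z : (T <= T')%N -> Bd + 1 <= modulus (iterate p T z) ->
    Bd + 1 <= modulus (iterate p T' z).
  move=> TT' h; rewrite -(subnK TT') /iterate iterD -/(iterate p T z).
  have hr : r <= modulus (iterate p T z) by lra.
  have [h1 _] := escape_iterate l0 hM (T' - T) hr.
  apply: le_trans h _; apply: le_trans h1; rewrite ler_peMl ?modulus_ge0 //.
  by rewrite exprn_ege1 // ler1n.
have local_good z : exists2 d, 0 < d & exists T, forall T' y,
    modulus (y - z) < d -> (T <= T')%N -> good T' y.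
  have [Kz|nKz] := pselect (filled_julia p z); last first.
    have [T hT] : exists T, Bd + 2 < modulus (iterate p T z).
      apply: contrapT => hT; apply: nKz; apply/filled_juliaP.
      exists (Bd + 2) => T; rewrite leNgt; apply/negP => h; apply: hT; by exists T.
    have [L L0 hL] := horner_lipschitz (iter_poly p T) (modulus z + 1).
    have [d d0 hd] := small_factor L0 ltr01.
    exists (Num.min d 1); first by rewrite lt_min d0 ltr01.
    exists T => T' y; rewrite lt_min => /andP[y1 y2] TT'; apply: Or33.
    apply: (mono T) => //.
    have yz : modulus y <= modulus z + 1 by have := modulus_sub_ge y z; lra.
    have zz : modulus z <= modulus z + 1 by lra.
    have h : modulus (iterate p T y - iterate p T z) <= 1.
      rewrite -!iter_poly_horner; apply: le_trans (hL y z yz zz) _.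
      by apply: hd; rewrite modulus_ge0 ltW.
    have := modulus_sub_ge (iterate p T z) (iterate p T y).
    by rewrite modulusBC; lra.
  have [[d d0 hd]|hb] := pselect (exists2 d, 0 < d &
      forall y, modulus (y - z) < d -> filled_julia p y).
    by exists d => //; exists 0%N => T' y /hd Ky _; exact: Or31.
  have Jz : julia p z.
    apply/juliaP => d d0; split; first by exists z => //; rewrite subrr modulus0.
    apply: contrapT => hd; apply: hb; exists d => // y hy.
    by apply: contrapT => Ky; apply: hd; exists y.
  have [h h0 hv] := vicinity_julia e0.
  exists h => //; exists 0%N => T' y hy _; apply: Or32.
  by apply: (hv _ z) => //; exact: ltW.
pose K := `[- Bd, Bd] `*` `[- Bd, Bd].
have cK : compact K by apply: compact_setX; exact: segment_compact.
move/compact_near_coveringP : cK => /(_ nat \oo (fun T ab => good T (ab.1 +i* ab.2)%C)).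
case.
  move=> [a b] _; have [d d0 [T hT]] := local_good (a +i* b)%C.
  exists (ball (a, b) (d / 2), [set T' | (T <= T')%N]).
    split; last by exists T.
    by apply: nbhsx_ballx; rewrite divr_gt0.
  move=> [[a' b'] T'] /= [[ha hb] TT']; apply: hT => //.
  move: ha hb; rewrite /ball /= => ha hb.
  apply: le_lt_trans (modulus_le_ReIm _) _; rewrite ReB ImB /=.
  rewrite [`|a' - a|]distrC [`|b' - b|]distrC; lra.
move=> T _ hT; exists T => -[a b] hz.
apply: (hT T (leqnn T) (a, b)); split; rewrite /= in_itv /=.
  by have := le_trans (Re_le_modulus _) hz; rewrite ler_norml.
by have := le_trans (Im_le_modulus _) hz; rewrite ler_norml.
Qed.

(** All that a certificate has to know about p, in a form that is robust under
[h]-perturbations: outside [V] both the filled Julia set and its complement are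
invariant, the latter with increasing height [s]; on [V] the weight expands. *)
Lemma lyapunov_exists (Bd : R) : r <= Bd ->
  exists (V : C R -> Prop) (s : C R -> R) (h : R),
  [/\ 0 < h, forall z, 0 <= s z & forall z q,
    modulus z <= Bd -> modulus q <= Bd -> modulus (q - p.[z]) <= h ->
    [/\ ~ V z -> ~ V q,
        ~ V z -> (filled_julia p z <-> filled_julia p q),
        ~ V z -> ~ filled_julia p z -> s z + 1 / 2 <= s q &
        V z -> forall X, modulus p^`().[z] ^+ 2 - 2 * h <= X ->
          rho z + 1 / 2 <= rho q * X]].
Proof.
move=> rB.
have [e1 e10 hback] := vicinity_backward.
have [Lg Lg0 hLg] := sqr_lipschitz (iter_poly p n.+1)^`() (r + 1).
have quarter : 0 < (1 / 4 : R) by lra.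
(* within [e2] of the Julia set, |(p^n)'|^2 is still at least 7/4 *)
have [e2 e20 he2] := small_factor Lg0 quarter.
pose e := Num.min 1 (Num.min e1 e2).
have e0 : 0 < e by rewrite !lt_min ltr01 e10 e20.
have e_1 : e <= 1 by rewrite ge_min lexx.
have ee1 : e <= e1 by rewrite !ge_min lexx orbT.
have ee2 : e <= e2 by rewrite !ge_min lexx !orbT.
have [|h1 h10 hb] := hback e; first by rewrite e0.
have [h2 h20 hj] := vicinity_julia e0.
have [T hT] := uniform_escape e0 rB.
have [Ls Ls0 hLs] := sumsq_lipschitz (iter_poly p) T (Bd + 1).
have [Lr Lr0 hLr] := sumsq_lipschitz (fun j => (iter_poly p j)^`()) n.+1 (Bd + 1).
have [P P0 hP] := horner_bounded p^`() (Bd + 1).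
have [W W1 hW] := sumsq_bounded (fun j => (iter_poly p j)^`()) n.+1 (Bd + 1).
have half : 0 < (1 / 2 : R) by lra.
(* [h3] and [h4] limit the loss of height and of expansion *)
have [h3 h30 hh3] := small_factor Ls0 half.
have a0 : 0 <= Lr * P ^+ 2 + 2 * W by rewrite addr_ge0 ?mulr_ge0 ?sqr_ge0 //; lra.
have [h4 h40 hh4] := small_factor a0 quarter.
pose h := Num.min 1 (Num.min h1 (Num.min h2 (Num.min h3 h4))).
have h0 : 0 < h by rewrite !lt_min ltr01 h10 h20 h30 h40.
have h_1 : h <= 1 by rewrite !ge_min lexx.
have hh1 : h <= h1 by rewrite !ge_min lexx !orbT.
have hh2 : h <= h2 by rewrite !ge_min lexx !orbT.
have h_3 : h <= h3 by rewrite !ge_min lexx !orbT.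
have h_4 : h <= h4 by rewrite !ge_min lexx !orbT.
exists (vicinity e), (height p T), h; split=> //; first by move=> z; exact: sumsq_ge0.
move=> z q hz hq hzq.
have hq' : modulus q <= Bd + 1 by rewrite (le_trans hq) // lerDl.
have hz' : modulus z <= Bd + 1 by rewrite (le_trans hz) // lerDl.
have hpz : modulus p.[z] <= Bd + 1.
  by have := modulus_sub_ge p.[z] q; rewrite modulusBC; lra.
have V1 : ~ vicinity e z -> ~ vicinity e q.
  by move=> nV Vq; apply: nV; apply: (hb z q) => //; lra.
split=> //.
- move=> /V1 nVq; have Vq w : julia p w -> modulus (w - q) <= modulus (q - p.[z]) -> False.
    move=> Jw hw; apply: nVq; apply: (hj _ w) => //.
    by rewrite modulusBC; lra.
  have K1 := filled_julia_horner p z.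
  split=> [/K1 Kz|Kq]; apply: contrapT => nK.
    have [w Jw [_ hw]] := julia_between Kz nK; exact: (Vq w).
  have nKz : ~ filled_julia p p.[z] by move=> /K1.
  have [w Jw [hw _]] := julia_between Kq nKz; apply: (Vq w) => //.
  by rewrite [leRHS]modulusBC.
- move=> nV nK; have [//|//|hTz] := hT z hz.
  have := hLs q p.[z] hq' hpz; rewrite -/(height p T q) -/(height p T p.[z]).
  rewrite height_horner ler_norml => /andP[+ _].
  have : Ls * modulus (q - p.[z]) <= 1 / 2.
    by apply: hh3; rewrite modulus_ge0; lra.
  have z0 : 0 <= modulus z by exact: modulus_ge0.
  have : (Bd + 1) ^+ 2 <= modulus (iterate p T z) ^+ 2.
    by apply: lerXn2r; rewrite ?nnegrE ?modulus_ge0 //; lra.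
  have : modulus z ^+ 2 <= Bd ^+ 2 by apply: lerXn2r; rewrite ?nnegrE //; lra.
  have -> : (Bd + 1) ^+ 2 = Bd ^+ 2 + 2 * Bd + 1 by ring.
  by lra.
move=> /(vicinity_dist e0)[w Jw [zw _]] X hX.
have wr : modulus w <= r + 1 by have := escape_julia l0 hM Jw; lra.
have zr : modulus z <= r + 1.
  by have := modulus_sub_ge z w; have := escape_julia l0 hM Jw; lra.
have g1 : 7 / 4 <= modulus (multiplier p n.+1 z) ^+ 2.
  have := hLg z w zr wr; rewrite -/(multiplier p n.+1 z) -/(multiplier p n.+1 w).
  rewrite ler_norml => /andP[+ _]; have := hn Jw.
  have : Lg * modulus (z - w) <= 1 / 4 by apply: he2; rewrite modulus_ge0; lra.
  lra.
have g2 := weight_horner p n.+1 z.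
have g3 : rho p.[z] - Lr * h <= rho q.
  have := hLr q p.[z] hq' hpz; rewrite -/(rho q) -/(rho p.[z]) ler_norml => /andP[+ _].
  have : Lr * modulus (q - p.[z]) <= Lr * h by apply: ler_wpM2l.
  lra.
apply: (perturbed_gain (K := Lr) (h := h) (P := P ^+ 2) (W := W) _ _ _ _ _ _ g3
  g2 g1 _ hX) => //.
- exact: ltW.
- exact: sqr_ge0.
- by apply: lerXn2r; rewrite ?nnegrE ?modulus_ge0 ?hP.
- exact: sumsq_ge0.
- exact: hW.
by apply: hh4; rewrite ltW.
Qed.

End Lyapunov.

(** * Every hyperbolic polynomial has a certificate *)
Lemma exists_digits (b m Y : nat) (g : nat -> nat) :
  (forall i, (i < m)%N -> (g i <= b)%N) -> exists2 x, (Y <= x)%N &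
  forall i, (i < m)%N -> ((x %/ b.+1 ^ i) %% b.+1)%N = g i.
Proof.
elim: m g => [|m IH] g hg; first by exists Y.
have [|x hx hd] := IH (fun i => g i.+1); first by move=> i im; exact: hg.
have h0 : (g 0%N < b.+1)%N by rewrite ltnS hg.
exists (x * b.+1 + g 0%N)%N => [|[|i] im]; first by nia.
  by rewrite expn0 divn1 modnMDl modn_small.
by rewrite expnS divnMA divnMDl // (divn_small h0) addn0 hd.
Qed.

Section OracleBounds.
Variables (R : realType) (l : nat) (c : 'rV[C R]_l).
Variable phi : nat -> 'rV[rat]_(l + l).
Hypothesis horacle : is_oracle (realify c) phi.

Lemma oracle_entry x j :
  `|ratr (phi x 0 j) - realify c 0 j| <= 2 ^- x :> R.
Proof.
apply: le_trans (ltW (horacle x)).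
rewrite /euclidean_norm -sqrtr_sqr; apply: ler_wsqrtr.
rewrite (bigD1 j) //= !mxE lerDl; apply: sumr_ge0 => i _; exact: sqr_ge0.
Qed.

Lemma precision_le (N x : nat) : (N <= x)%N -> 2 ^- x <= N.+1%:R^-1 :> R.
Proof.
move=> Nx; rewrite lef_pV2 ?posrE ?ltr0n ?exprn_gt0 //.
by rewrite -natrX ler_nat; exact: leq_ltn_trans Nx (ltn_expl x (ltnSn 1)).
Qed.

Lemma oracle_approximant (N x : nat) i : (N <= x)%N ->
  modulus (c 0 i - approximant R (phi x) 0 i) <= 2 / N.+1%:R.
Proof.
move=> Nx; have h := precision_le Nx.
apply: le_trans (modulus_le_ReIm _) _; rewrite ReB ImB !mxE /=.
have := oracle_entry x (lshift l i); have := oracle_entry x (rshift l i).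
rewrite /realify row_mxEl row_mxEr !mxE => h1 h2.
rewrite [`|complex.Re _ - _|]distrC [`|complex.Im _ - _|]distrC.
move: h h1 h2; set e := N.+1%:R^-1; set e' := 2 ^- x; lra.
Qed.

Lemma oracle_bounded_entries : exists A, (forall i, modulus (c 0 i) <= (2 * A + 2)%:R) /\
  forall x, bounded_entries R A (phi x).
Proof.
pose S := \sum_j `|realify c 0 j|.
have hS j : `|realify c 0 j| <= S.
  by rewrite /S (bigD1 j) //= lerDl sumr_ge0.
have hA := truncnS_gt (S + 1).
set A := (Num.truncn (S + 1)).+1 in hA; exists A; split=> [i|x].
  apply: le_trans (modulus_le_ReIm _) _.
  have := hS (lshift l i); have := hS (rshift l i).
  rewrite /realify row_mxEl row_mxEr !mxE natrD natrM; lra.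
apply/forallP => j; have h1 := oracle_entry x j.
have h2 : 2 ^- x <= 1 :> R by rewrite invf_le1 ?exprn_gt0 // exprn_ege1 // ler1n.
have h3 := le_trans h1 h2; have h4 := hS j.
have := ler_normD (ratr (phi x 0 j) - realify c 0 j) (realify c 0 j).
rewrite subrK => h5; rewrite -ler_norml; lra.
Qed.

End OracleBounds.

Section Completeness.
Variables (R : realType) (l : nat) (c : 'rV[C R]_l).
Variable phi : nat -> 'rV[rat]_(l + l).
Hypothesis l0 : (0 < l)%N.
Hypothesis horacle : is_oracle (realify c) phi.
Local Notation p := (@monic_centered R l.+1 c).

(** Nodes are labelled by [lyapunov_exists], the weight and the height being
multiplied by 4 before rounding so that their gains of 1/2 exceed the rounding
errors. The mesh is chosen after all constants of the dynamics, then the base of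
the digits, and the number that codes the table last. *)
Lemma hyperbolic_accepted : hyperbolic p -> exists x, accepts R (x, phi x).
Proof.
move=> hyp; have [A [cA hA]] := oracle_bounded_entries horacle.
have [n hn] := expanding_time hyp.
pose B : R := (box l A)%:R.
have BE : B = l%:R * (2 * A + 2)%:R + 2 + 1 := boxE R l A.
have B0 : 3 <= B by rewrite BE; have : 0 <= l%:R * (2 * A + 2)%:R :> R; [exact: mulr_ge0|lra].
have [|V [s [h [h0 s0 H]]]] := lyapunov_exists l0 cA hn (Bd := 2 * B); first by lra.
pose rho := weight p n.+1.
have rho0 z : 0 <= rho z by exact: sumsq_ge0.
pose h' := Num.min (1 / 2) h.
have h'0 : 0 < h' by rewrite lt_min h0 andbT; lra.
have h'h : h' <= h by rewrite ge_min lexx orbT.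
have h'half : h' <= 1 / 2 by rewrite ge_min lexx.
pose G : R := (slack l A)%:R.
have G0 : 0 <= G by exact: ler0n.
(* by [arrow_dist] this mesh turns arrows into h'-pseudo-orbits *)
have [N hN] : exists N : nat, (3 * G + 2) / N.+1%:R <= h'.
  exists (Num.truncn ((3 * G + 2) / h')); rewrite ler_pdivrMr ?ltr0n // [leRHS]mulrC.
  by rewrite -ler_pdivrMr //; apply: ltW; exact: truncnS_gt.
pose z i j := cell R l A N i j.
pose lab i j : nat := if `[< V (z i j) >] then (3 * Num.truncn (4 * rho (z i j)) + 2)%N
  else if `[< filled_julia p (z i j) >] then 0%N else (3 * Num.truncn (4 * s (z i j)) + 1)%N.
pose sd := side l A N.
pose g k := lab (k %/ sd)%N (k %% sd)%N.
pose b := (\sum_(k < sd * sd) g k)%N.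
have [|x hx hd] := @exists_digits b (sd * sd) (maxn A (maxn N b)) g.
  by move=> k hk; rewrite /b (bigD1 (Ordinal hk)) //= leq_addr.
have [Ax Nx bx] : [/\ (A < x.+1)%N, (N < x.+1)%N & (b < x.+1)%N].
  by move: hx; rewrite !geq_max => /and3P[? ? ?]; split.
exists x; apply/existsP; exists (Ordinal Ax); apply/existsP; exists (Ordinal Nx).
apply/existsP; exists (Ordinal bx) => /=.
have labE (i j : 'I_sd) : label l x A N b i j = lab i j.
  rewrite /label hd; last first.
    by have := ltn_ord i; have := ltn_ord j; rewrite -/sd; nia.
  rewrite /g divnMDl; last by rewrite /sd /side.
  by rewrite (divn_small (ltn_ord j)) addn0 modnMDl modn_small.
have Nx' : (N <= x)%N by rewrite -ltnS.
have hc i := oracle_approximant horacle i Nx'.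
have hv := hA x.
have zB (i j : 'I_sd) : modulus (z i j) <= 2 * B by exact: cell_bound.
have GN0 : 0 <= G / N.+1%:R by rewrite divr_ge0.
have [hG hN'] : 2 * (G / N.+1%:R) <= 1 /\ G / N.+1%:R <= h.
  have := mesh_gt0 R N; move: hN; rewrite mulrDl -mulrA.
  move: GN0; set g1 := G / _; set e := _^-1; lra.
apply/andP; split=> //.
apply/forallP => i; apply/forallP => j; apply/andP; split.
  apply/implyP; rewrite /= /kind labE /lab.
  case: asboolP => [_|nV]; first by rewrite mulnC modnMDl.
  case: asboolP => [Kz _|_]; last by rewrite mulnC modnMDl.
  apply: (in_box_cell l0 hv hc) => //; exact/filled_julia_horner.
apply/forallP => i'; apply/forallP => j'; apply/implyP => /= harrow.
have hdist := le_trans (le_trans (arrow_dist l0 hv hc harrow) hN) h'h.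
have [F1 F2 F3 F4] := H _ _ (zB i j) (zB i' j') hdist.
rewrite /arrow_ok /= /kind /value !labE.
have k1 m : ((3 * m + 1) %% 3 = 1)%N by rewrite mulnC modnMDl.
have k2 m : ((3 * m + 2) %% 3 = 2)%N by rewrite mulnC modnMDl.
have v1 m : ((3 * m + 1) %/ 3 = m)%N by rewrite mulnC divnMDl // addn0.
have v2 m : ((3 * m + 2) %/ 3 = m)%N by rewrite mulnC divnMDl // addn0.
apply/and3P; split.
- apply/implyP; rewrite {1}/lab; case: asboolP => [_|nV]; first by rewrite ?k1 ?k2.
  case: asboolP => [Kz _|_]; last by rewrite ?k1 ?k2.
  rewrite /lab; case: asboolP => [/(F1 nV)//|_].
  by case: asboolP => // nK; case: nK; apply/(F2 nV).
- apply/implyP; rewrite {1}/lab; case: asboolP => [_|nV]; first by rewrite ?k1 ?k2.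
  case: asboolP => [//|nK] _.
  rewrite {1}/lab; case: asboolP => [/(F1 nV)//|nV'].
  case: asboolP => [/(F2 nV)//|nK'].
  rewrite k1 eqxx /= /lab (asboolF nV) (asboolF nK) (asboolF nV') (asboolF nK') ?v1 ?v2.
  rewrite truncn_gt_nat -natr1.
  have := truncn_le (4 * s (z i j)); rewrite mulr_ge0 ?s0 // => t1.
  by have := F3 nV nK; lra.
apply/implyP => /andP[].
rewrite {1}/lab; case: asboolP => [Vz _|nV]; last by case: asboolP; rewrite ?k1 ?k2.
rewrite {1}/lab; case: asboolP => [Vz' _|nV']; last by case: asboolP; rewrite ?k1 ?k2.
rewrite /lab !asboolT // ?v1 ?v2.
set X := expansion _ _ _ _ _ _.
have hX : modulus p^`().[z i j] ^+ 2 - 2 * h <= X.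
  apply: le_trans (expansion_ge l0 hv hc x i j); rewrite lerD2l lerN2 -/G.
  by rewrite ler_pM2l.
have r1 := F4 Vz X hX.
have r0 := rho0 (z i j); have r0' := rho0 (z i' j').
rewrite -/rho in r1.
(* otherwise the weight would not be positive *)
have X0 : 0 <= X.
  rewrite leNgt; apply/negP => Xn; have : rho (z i' j') * X <= 0.
    by rewrite mulr_ge0_le0 // ltW.
  lra.
have := truncn_le (4 * rho (z i j)); rewrite mulr_ge0 // => t1.
have t2 := truncnS_gt (4 * rho (z i' j')).
have t3 : X * (4 * rho (z i' j')) <= X * (Num.truncn (4 * rho (z i' j'))).+1%:R.
  by apply: ler_wpM2l => //; exact: ltW.
have -> : (Num.truncn (4 * rho (z i j))).+2%:R =
  (Num.truncn (4 * rho (z i j)))%:R + 1 + 1 :> R by rewrite !natr1.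
apply: le_trans t3; have -> : X * (4 * rho (z i' j')) = 4 * (rho (z i' j') * X) by ring.
by move: t1 => /= t1; lra.
Qed.

Lemma accepted_hyperbolic x : accepts R (x, phi x) -> hyperbolic p.
Proof.
move=> /existsP[A /existsP[N /existsP[b ok]]].
apply: (valid_hyperbolic l0 _ ok) => i.
by apply: oracle_approximant => //; rewrite -ltnS.
Qed.

End Completeness.

(** * The theorem *)
Local Close Scope ring_scope.
Local Close Scope classical_set_scope.
Local Close Scope nat_scope.

Theorem corollary1p2 (R : realType) (d : nat) (hd : (2 <= d)%N) :
  exists M : oracle_machine,
    forall (c : 'rV[C R]_(d.-1)) (phi : nat -> 'rV[rat]_(d.-1 + d.-1)),
      is_oracle (realify c) phi ->
      (hyperbolic (monic_centered c) -> halts M phi) /\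
      (~ hyperbolic (monic_centered c) -> runs_forever M phi).
Proof.
case: d hd => // l l0; have [M hM] := semidecidable (accepts_computable R l).
exists M => c phi horacle; split=> [hyp|nhyp t ht].
  by apply/hM; exact: hyperbolic_accepted.
apply: nhyp; have /hM[x hx] : halts M phi by exists t.
exact: accepted_hyperbolic hx.
Qed.
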